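(* Let $G$ be an algebraic subgroup of $\mathrm{PGL}_2(\mathbb C(y))\rtimes\mathrm{Aff}_1$ isomorphic to the multiplicative algebraic group $(\mathbb C^*,\times)$. Then the following assertions are equivalent: (1) the map $\mathrm{pr}_2\colon\mathrm{PGL}_2(\mathbb C(y))\rtimes\mathrm{Aff}_1\to\mathrm{Aff}_1$ induces an isomorphism $G\to\mathrm{pr}_2(G)$; (2) the groups $G$ and $\mathbb T_{0,1}$ are conjugate in $\mathrm{PGL}_2(\mathbb C(y))\rtimes\mathrm{Aff}_1$.
   Context: $\mathrm{Bir}(\mathbb P^2)$ is the group of birational transformations of the complex projective plane, identified with $\mathrm{Bir}(\mathbb A^2)$ via $(x,y)\mapsto[x:y:1]$. Zariski topology. For an irreducible complex algebraic variety $A$, a morphism $A\to\mathrm{Bir}(\mathbb P^2)$ is a map $a\mapsto f_a$ arising from an $A$-birational map $f$ of $A\times\mathbb P^2$ that induces an isomorphism $U\to V$ between open subsets $U,V\subseteq A\times \mathbb P^2$ whose projections to $A$ are both surjective, where $f_a$ is $w\dashrightarrow p_2(f(a,w))$ and $p_2$ is the second projection. A subset $F\subseteq\mathrm{Bir}(\mathbb P^2)$ is closed if its preimage under every such morphism (for every $A$) is closed in $A$. An algebraic subgroup of $\mathrm{Bir}(\mathbb P^2)$ is a closed subgroup whose elements have bounded degree; it carries a natural structure of algebraic group. $\mathrm{PGL}_2(\mathbb C(y))\rtimes\mathrm{Aff}_1$ denotes the closed subgroup of $\mathrm{Bir}(\mathbb P^2)$ consisting of the maps $(x,y)\dashrightarrow\left(\frac{\alpha(y)x+\beta(y)}{\gamma(y)x+\delta(y)},ay+b\right)$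 with $\begin{pmatrix}\alpha&\beta\\ \gamma&\delta\end{pmatrix}\in\mathrm{PGL}_2(\mathbb C(y))$, $a\in\mathbb C^*$, $b\in\mathbb C$; $\mathrm{Aff}_1=\mathrm{Aff}_1(\mathbb C)$ and $\mathrm{pr}_2$ sends such a map to $y\mapsto ay+b$. $\mathbb T_{0,1}=\{(x,ty):t\in\mathbb C^*\}$. *)

(* Defs.v *)
From HB Require Import structures.
From mathcomp Require Import all_boot all_fingroup all_algebra.
From mathcomp Require Import generic_quotient fraction.
From mathcomp Require Import mpoly.
From mathcomp Require Import boolp classical_sets reals.
From mathcomp Require Import complex.

Set Implicit Arguments.
Unset Strict Implicit.
Unset Printing Implicit Defensive.

Import GRing.Theory.

Local Open Scope quotient_scope.
Local Open Scope classical_set_scope.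
Local Open Scope ring_scope.

(* A variety is a topological space together with a sheaf of k-algebras of    *)
(* k-valued functions.  The sheaf is given by its germs: [regular f x] says   *)
(* that the function f is regular in a neighbourhood of x, so that the        *)
(* sections over an open set U are the f with [U `<=` regular f], the values  *)
(* of f outside U being irrelevant by [regular_local].                        *)
Record geometry (k : fieldType) (T : Type) := Geometry {
  zopen_of : set (set T);
  regular_of : (T -> k) -> set T;
  zopenT_of : zopen_of setT;
  zopenI_of : forall U V, zopen_of U -> zopen_of V -> zopen_of (U `&` V);
  zopen_bigcup_of : forall F : set (set T),
    F `<=` zopen_of -> zopen_of (\bigcup_(U in F) U);
  regular_open_of : forall f, zopen_of (regular_of f);
  regular_local_of : forall U f g, zopen_of U -> {in U, f =1 g} ->
    U `&` regular_of f `<=` regular_of g;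
  regularC_of : forall c x, regular_of (fun=> c) x;
  regularD_of : forall f g x, regular_of f x -> regular_of g x ->
    regular_of (fun y => f y + g y) x;
  regularM_of : forall f g x, regular_of f x -> regular_of g x ->
    regular_of (fun y => f y * g y) x }.

Record kspace (k : fieldType) := KSpace {
  pt :> Type;
  geom : geometry k pt }.

Section Spaces.
Variable k : fieldType.
Implicit Types X Y Z : kspace k.

Definition zopen X : set (set X) := zopen_of (geom X).
Definition regular X : (X -> k) -> set X := regular_of (geom X).
Definition zclosed X (F : set X) := zopen (~` F).
Definition zdense X (W : set X) :=
  forall O : set X, zopen O -> O !=set0 -> (O `&` W) !=set0.

Definition irreducible X :=
  [set: X] !=set0 /\
  forall F1 F2 : set X, zclosed F1 -> zclosed F2 ->
    F1 `|` F2 = setT -> F1 = setT \/ F2 = setT.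

Definition morphism_at X Y (f : X -> Y) (x : X) :=
  (forall V : set Y, zopen V -> V (f x) ->
     exists U : set X, [/\ zopen U, U x & U `<=` f @^-1` V]) /\
  (forall g : Y -> k, regular g (f x) -> regular (g \o f) x).

(* For U open this says that the restriction of f to U is a morphism. *)
Definition morphism_on X Y (U : set X) (f : X -> Y) :=
  forall x, U x -> morphism_at f x.

Definition morphism X Y (f : X -> Y) := morphism_on setT f.

Definition isomorphism X Y (f : X -> Y) :=
  morphism f /\
  exists g : Y -> X, [/\ morphism g, cancel f g & cancel g f].

Definition isomorphic X Y := exists f : X -> Y, isomorphism f.

Lemma zopenT X : zopen [set: X]. Proof. exact: zopenT_of. Qed.

Lemma zopenI X (U V : set X) : zopen U -> zopen V -> zopen (U `&` V).
Proof. exact: zopenI_of. Qed.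

Lemma zopen_nbhs X (W : set X) :
  (forall x, W x -> exists U : set X, [/\ zopen U, U x & U `<=` W]) -> zopen W.
Proof.
move=> h; have -> : W = \bigcup_(U in [set U | zopen U /\ U `<=` W]) U.
  apply/seteqP; split=> [x Wx|x [U [_ UW] Ux]]; last exact: UW.
  by have [U [oU Ux UW]] := h _ Wx; exists U.
by apply: zopen_bigcup_of => U [].
Qed.

Lemma regular_open X (f : X -> k) : zopen (regular f).
Proof. exact: regular_open_of. Qed.

Lemma regular_local X (U : set X) (f g : X -> k) (x : X) : zopen U -> U x ->
  (forall y, U y -> f y = g y) -> regular f x -> regular g x.
Proof.
move=> oU Ux fg rf; apply: (regular_local_of oU (f := f)) => [y|]; last by split.
by rewrite inE; exact: fg.
Qed.

Section Affine.
Variable n : nat.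
Local Notation V := 'rV[k]_n.

Definition peval (p : {mpoly k[n]}) (v : V) : k := p.@[v ord0].

Definition zeros (S : set {mpoly k[n]}) : set V :=
  [set v | forall p, S p -> peval p v = 0].

Definition affine_open : set (set V) := [set U | exists S, ~` U = zeros S].

Definition affine_regular (f : V -> k) : set V :=
  [set v | exists p q (U : set V), [/\ affine_open U, U v &
     forall w, U w -> peval q w != 0 /\ f w = peval p w / peval q w]].

Lemma affine_openP (U : set V) : affine_open U <->
  forall v, U v -> exists p, peval p v != 0 /\ forall w, peval p w != 0 -> U w.
Proof.
split=> [[S SU] v Uv|h].
  have : ~ zeros S v by rewrite -SU; exact.
  move=> /existsNP[p /not_implyP[Sp /eqP pv]]; exists p; split=> // w pw.
  apply: contrapT; rewrite -[~ U w]/((~` U) w) SU => /(_ p Sp) /eqP.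
  by rewrite (negbTE pw).
exists [set p | forall w, peval p w != 0 -> U w].
apply/seteqP; split=> [v nUv p /= pU|v zv Uv].
  by apply/eqP; apply: contraT => /pU.
by have [p [pv pU]] := h _ Uv; rewrite zv ?eqxx in pv.
Qed.

Lemma affine_openT : affine_open setT.
Proof.
apply/affine_openP => v _; exists 1; split=> //.
by rewrite /peval meval1 oner_neq0.
Qed.

Lemma affine_openI (U U' : set V) :
  affine_open U -> affine_open U' -> affine_open (U `&` U').
Proof.
move=> /affine_openP h /affine_openP h'; apply/affine_openP => v [Uv Uv'].
have [p [pv pU]] := h _ Uv; have [p' [pv' pU']] := h' _ Uv'.
exists (p * p'); rewrite /peval mevalM mulf_neq0 //; split=> // w.
by rewrite mevalM mulf_eq0 negb_or => /andP[/pU ? /pU' ?].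
Qed.

Lemma affine_open_bigcup (F : set (set V)) :
  F `<=` affine_open -> affine_open (\bigcup_(U in F) U).
Proof.
move=> h; apply/affine_openP => v [U FU Uv].
have [p [pv pU]] := (affine_openP _).1 (h _ FU) _ Uv.
by exists p; split=> // w /pU Uw; exists U.
Qed.

Lemma affine_regular_open f : affine_open (affine_regular f).
Proof.
apply/affine_openP => v [p [q [U [oU Uv h]]]].
have [r [rv rU]] := (affine_openP _).1 oU _ Uv.
by exists r; split=> // w /rU Uw; exists p, q, U.
Qed.

Lemma affine_regular_local (U : set V) f g : affine_open U -> {in U, f =1 g} ->
  U `&` affine_regular f `<=` affine_regular g.
Proof.
move=> oU fg v [Uv [p [q [U' [oU' Uv' h]]]]].
exists p, q, (U `&` U'); split=> [||w [Uw Uw']]; [exact: affine_openI|by []|].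
by rewrite -fg ?inE//; exact: h.
Qed.

Lemma affine_regularC c v : affine_regular (fun=> c) v.
Proof.
exists c%:MP, 1, setT; split=> [||w _] //; first exact: affine_openT.
by rewrite /peval meval1 mevalC divr1 oner_neq0.
Qed.

Lemma affine_regularD f g v : affine_regular f v -> affine_regular g v ->
  affine_regular (fun w => f w + g w) v.
Proof.
move=> [p [q [U [oU Uv h]]]] [p' [q' [U' [oU' Uv' h']]]].
exists (p * q' + p' * q), (q * q'), (U `&` U').
split=> [||w [Uw Uw']]; [exact: affine_openI|by []|].
have [q0 ->] := h _ Uw; have [q0' ->] := h' _ Uw'.
by rewrite /peval mevalD !mevalM mulf_neq0 // addf_div.
Qed.

Lemma affine_regularM f g v : affine_regular f v -> affine_regular g v ->
  affine_regular (fun w => f w * g w) v.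
Proof.
move=> [p [q [U [oU Uv h]]]] [p' [q' [U' [oU' Uv' h']]]].
exists (p * p'), (q * q'), (U `&` U').
split=> [||w [Uw Uw']]; [exact: affine_openI|by []|].
have [q0 ->] := h _ Uw; have [q0' ->] := h' _ Uw'.
by rewrite /peval !mevalM mulf_neq0 // mulf_div.
Qed.

Definition affine : kspace k := KSpace (Geometry affine_openT affine_openI
  affine_open_bigcup affine_regular_open affine_regular_local
  affine_regularC affine_regularD affine_regularM).

End Affine.

(* The geometry induced on T by an injection j : T -> X. *)
Section Induced.
Variables (T : Type) (X : kspace k) (j : T -> X).

Definition induced_open : set (set T) :=
  [set U | exists2 O : set X, zopen O & U = j @^-1` O].

Definition induced_regular (f : T -> k) : set T :=
  [set t | exists (O : set X) (g : X -> k), [/\ zopen O, O (j t),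
     regular g (j t) & forall s, O (j s) -> f s = g (j s)]].

Lemma induced_openT : induced_open setT.
Proof. by exists setT => //; exact: zopenT. Qed.

Lemma induced_openI U V :
  induced_open U -> induced_open V -> induced_open (U `&` V).
Proof. by move=> [O oO ->] [O' oO' ->]; exists (O `&` O') => //; exact: zopenI. Qed.

Lemma induced_open_bigcup (F : set (set T)) :
  F `<=` induced_open -> induced_open (\bigcup_(U in F) U).
Proof.
move=> h; exists (\bigcup_(O in [set O | zopen O /\ F (j @^-1` O)]) O).
  by apply: zopen_bigcup_of => O [].
apply/seteqP; split=> [t [U FU Ut]|t [O [oO FO] Ot]]; last by exists (j @^-1` O).
by have [O oO e] := h _ FU; rewrite e in FU Ut; exists O.
Qed.

Lemma induced_regular_open f : induced_open (induced_regular f).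
Proof.
have -> : induced_regular f = \bigcup_(U in
    [set U | induced_open U /\ U `<=` induced_regular f]) U.
  apply/seteqP; split=> [t [O [g [oO Ot rg fg]]]|t [U [_ h]] Ut]; last exact: h.
  exists (j @^-1` (O `&` regular g)) => //; split.
    by exists (O `&` regular g) => //; apply: zopenI => //; exact: regular_open.
  by move=> s [Os rs]; exists O, g.
by apply: induced_open_bigcup => U [].
Qed.

Lemma induced_regular_local (U : set T) f g : induced_open U -> {in U, f =1 g} ->
  U `&` induced_regular f `<=` induced_regular g.
Proof.
move=> [O oO ->] fg t [Ot [O' [h [oO' Ot' rh fh]]]].
exists (O `&` O'), h; split=> [||//|s [Os Os']]; [exact: zopenI|by []|].
by rewrite -fg ?inE//; exact: fh.
Qed.

Lemma induced_regularC c t : induced_regular (fun=> c) t.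
Proof. by exists setT, (fun=> c); split=> //; [exact: zopenT|exact: regularC_of]. Qed.

Lemma induced_regularD f g t : induced_regular f t -> induced_regular g t ->
  induced_regular (fun s => f s + g s) t.
Proof.
move=> [O [u [oO Ot ru fu]]] [O' [u' [oO' Ot' ru' gu]]].
exists (O `&` O'), (fun x => u x + u' x).
split=> [||//|s [Os Os']]; [exact: zopenI|by []|exact: regularD_of|].
by rewrite fu// gu.
Qed.

Lemma induced_regularM f g t : induced_regular f t -> induced_regular g t ->
  induced_regular (fun s => f s * g s) t.
Proof.
move=> [O [u [oO Ot ru fu]]] [O' [u' [oO' Ot' ru' gu]]].
exists (O `&` O'), (fun x => u x * u' x).
split=> [||//|s [Os Os']]; [exact: zopenI|by []|exact: regularM_of|].
by rewrite fu// gu.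
Qed.

Definition induced : geometry k T := Geometry induced_openT induced_openI
  induced_open_bigcup induced_regular_open induced_regular_local
  induced_regularC induced_regularD induced_regularM.

End Induced.

Definition sub X (H : set X) : kspace k := KSpace (induced (fun x : H => val x)).

(* The product of varieties: open sets and regular functions come from the    *)
(* finite sums of functions f(x) g(y), not from the product topology.         *)
Section Product.
Variables X Y : kspace k.

Definition tensor (U : set X) (V : set Y) (h : X * Y -> k) :=
  exists (I : finType) (f : I -> X -> k) (g : I -> Y -> k),
    [/\ forall i, U `<=` regular (f i), forall i, V `<=` regular (g i) &
        forall z, U z.1 -> V z.2 -> h z = \sum_i f i z.1 * g i z.2].

Definition prod_open : set (set (X * Y)) := [set W | forall z, W z ->
  exists (U : set X) (V : set Y) (h : X * Y -> k),
    [/\ zopen U /\ zopen V, U z.1 /\ V z.2, tensor U V h, h z != 0 &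
        forall z', U z'.1 -> V z'.2 -> h z' != 0 -> W z']].

Definition prod_regular (f : X * Y -> k) : set (X * Y) := [set z |
  exists (U : set X) (V : set Y) (p q : X * Y -> k),
    [/\ zopen U /\ zopen V, U z.1 /\ V z.2, tensor U V p /\ tensor U V q,
        q z != 0 &
        forall z', U z'.1 -> V z'.2 -> q z' != 0 -> f z' = p z' / q z']].

Lemma tensorS (U U' : set X) (V V' : set Y) h :
  U' `<=` U -> V' `<=` V -> tensor U V h -> tensor U' V' h.
Proof.
move=> sU sV [I [f [g [rf rg e]]]]; exists I, f, g; split=> [i x /sU|i y /sV|].
- exact: rf.
- exact: rg.
- by move=> z /sU ? /sV ?; exact: e.
Qed.

Lemma tensorC (U : set X) (V : set Y) c : tensor U V (fun=> c).
Proof.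
exists unit, (fun=> fun=> c), (fun=> fun=> 1).
split=> [i x _|i y _|z _ _]; [exact: regularC_of|exact: regularC_of|].
by rewrite (big_pred1 tt) ?mulr1// => -[].
Qed.

Lemma tensorD (U : set X) (V : set Y) h h' : tensor U V h -> tensor U V h' ->
  tensor U V (fun z => h z + h' z).
Proof.
move=> [I [f [g [rf rg e]]]] [I' [f' [g' [rf' rg' e']]]].
exists (I + I')%type,
  (fun i => match i with inl i => f i | inr i => f' i end),
  (fun i => match i with inl i => g i | inr i => g' i end).
split=> [[i|i]|[i|i]|z Uz Vz] //.
by rewrite e// e'// big_sumType.
Qed.

Lemma tensorM (U : set X) (V : set Y) h h' : tensor U V h -> tensor U V h' ->
  tensor U V (fun z => h z * h' z).
Proof.
move=> [I [f [g [rf rg e]]]] [I' [f' [g' [rf' rg' e']]]].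
exists (I * I')%type, (fun i x => f i.1 x * f' i.2 x),
  (fun i y => g i.1 y * g' i.2 y).
split=> [i x Ux|i y Vy|z Uz Vz].
- by apply: regularM_of; [exact: rf|exact: rf'].
- by apply: regularM_of; [exact: rg|exact: rg'].
rewrite e// e'// big_distrlr pair_bigA.
by apply: eq_bigr => i _; rewrite mulrACA.
Qed.

Lemma prod_openT : prod_open setT.
Proof.
move=> z _; exists setT, setT, (fun=> 1); split=> //.
- by split; exact: zopenT.
- exact: tensorC.
- exact: oner_neq0.
Qed.

Lemma prod_openI W W' : prod_open W -> prod_open W' -> prod_open (W `&` W').
Proof.
move=> o o' z [/o [U [V [h [[oU oV] [Uz Vz] th hz hW]]]]].
move=> /o' [U' [V' [h' [[oU' oV'] [Uz' Vz'] th' hz' hW']]]].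
exists (U `&` U'), (V `&` V'), (fun z => h z * h' z); split=> //.
- by split; exact: zopenI.
- by apply: tensorM; [apply: tensorS th|apply: tensorS th']; move=> ? [].
- by rewrite mulf_neq0.
- move=> z' [Uz1 Uz1'] [Vz1 Vz1']; rewrite mulf_eq0 negb_or => /andP[n n'].
  by split; [exact: hW|exact: hW'].
Qed.

Lemma prod_open_bigcup (F : set (set (X * Y))) :
  F `<=` prod_open -> prod_open (\bigcup_(U in F) U).
Proof.
move=> o z [W FW /(o _ FW) [U [V [h [oUV Uz th hz hW]]]]].
by exists U, V, h; split=> // z' Uz' Vz' /(hW _ Uz' Vz') Wz'; exists W.
Qed.

Lemma prod_regular_open f : prod_open (prod_regular f).
Proof.
move=> z [U [V [p [q [oUV UVz [tp tq] qz e]]]]]; exists U, V, q; split=> //.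
by move=> z' Uz' Vz' qz'; exists U, V, p, q.
Qed.

Lemma prod_regular_local (W : set (X * Y)) f g : prod_open W ->
  {in W, f =1 g} -> W `&` prod_regular f `<=` prod_regular g.
Proof.
move=> oW fg z [/oW [U [V [h [[oU oV] [Uz Vz] th hz hW]]]]].
move=> [U' [V' [p [q [[oU' oV'] [Uz' Vz'] [tp tq] qz e]]]]].
exists (U `&` U'), (V `&` V'), (fun z => h z * p z), (fun z => h z * q z).
split=> //.
- by split; exact: zopenI.
- by split; apply: tensorM; [apply: tensorS th|apply: tensorS tp
    |apply: tensorS th|apply: tensorS tq]; move=> ? [].
- by rewrite mulf_neq0.
- move=> z' [Uz1 Uz1'] [Vz1 Vz1']; rewrite mulf_eq0 negb_or => /andP[n n'].
  by rewrite -fg ?inE; [rewrite e// -mulf_div divff// mul1r|exact: hW].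
Qed.

Lemma prod_regularC c z : prod_regular (fun=> c) z.
Proof.
exists setT, setT, (fun=> c), (fun=> 1); split=> //.
- by split; exact: zopenT.
- by split; exact: tensorC.
- exact: oner_neq0.
- by rewrite divr1.
Qed.

Lemma prod_regularD f g z : prod_regular f z -> prod_regular g z ->
  prod_regular (fun w => f w + g w) z.
Proof.
move=> [U [V [p [q [[oU oV] [Uz Vz] [tp tq] qz e]]]]].
move=> [U' [V' [p' [q' [[oU' oV'] [Uz' Vz'] [tp' tq'] qz' e']]]]].
have tpI : tensor (U `&` U') (V `&` V') p by apply: tensorS tp => ? [].
have tqI : tensor (U `&` U') (V `&` V') q by apply: tensorS tq => ? [].
have tpI' : tensor (U `&` U') (V `&` V') p' by apply: tensorS tp' => ? [].
have tqI' : tensor (U `&` U') (V `&` V') q' by apply: tensorS tq' => ? [].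
exists (U `&` U'), (V `&` V'), (fun z => p z * q' z + p' z * q z),
  (fun z => q z * q' z); split=> //.
- by split; exact: zopenI.
- by split; [apply: tensorD|]; exact: tensorM.
- by rewrite mulf_neq0.
- move=> w [Uw Uw'] [Vw Vw']; rewrite mulf_eq0 negb_or => /andP[n n'].
  by rewrite e// e'// addf_div.
Qed.

Lemma prod_regularM f g z : prod_regular f z -> prod_regular g z ->
  prod_regular (fun w => f w * g w) z.
Proof.
move=> [U [V [p [q [[oU oV] [Uz Vz] [tp tq] qz e]]]]].
move=> [U' [V' [p' [q' [[oU' oV'] [Uz' Vz'] [tp' tq'] qz' e']]]]].
exists (U `&` U'), (V `&` V'), (fun z => p z * p' z), (fun z => q z * q' z).
split=> //.
- by split; exact: zopenI.
- by split; apply: tensorM; [apply: tensorS tp|apply: tensorS tp'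
    |apply: tensorS tq|apply: tensorS tq']; move=> ? [].
- by rewrite mulf_neq0.
- move=> w [Uw Uw'] [Vw Vw']; rewrite mulf_eq0 negb_or => /andP[n n'].
  by rewrite e// e'// mulf_div.
Qed.

Definition sprod : kspace k := KSpace (Geometry prod_openT prod_openI
  prod_open_bigcup prod_regular_open prod_regular_local
  prod_regularC prod_regularD prod_regularM).

End Product.

Definition prevariety X :=
  exists (m : nat) (U : 'I_m -> set X),
    [/\ forall i, zopen (U i), \bigcup_i U i = setT &
        forall i, exists (n : nat) (F : set (affine n)),
          zclosed F /\ isomorphic (sub (U i)) (sub F)].

Definition separated X :=
  @zclosed (sprod X X) [set z | z.1 = z.2].

Definition variety X := prevariety X /\ separated X.

(* Projective space as the quotient of A^(n+1) \ {0} by scaling; its points   *)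
(* are the lines of k^(n+1).                                                  *)
Section Projective.
Variable n : nat.

Definition line := {L : {vspace 'rV[k]_n.+1} | (\dim L == 1)%N}.

Fact dim_line1 : (\dim <[const_mx 1%R : 'rV[k]_n.+1]>%VS == 1)%N.
Proof.
rewrite dim_vline eqb1; apply/eqP => /matrixP /(_ ord0 ord0).
by rewrite !mxE => /eqP; rewrite oner_eq0.
Qed.

(* [hpt v] is the point with homogeneous coordinates v; the value at v = 0 is *)
(* irrelevant.                                                                *)
Definition hpt (v : 'rV[k]_n.+1) : line :=
  insubd (exist (fun L : {vspace 'rV[k]_n.+1} => (\dim L == 1)%N) _ dim_line1)
    <[v]>%VS.

Definition cone (U : set line) : set (affine n.+1) :=
  [set v | v != 0 /\ U (hpt v)].

Definition proj_open : set (set line) := [set U | zopen (cone U)].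

Definition proj_regular (f : line -> k) : set line :=
  [set L | forall v : affine n.+1, v != 0 -> hpt v = L ->
     regular (f \o hpt : affine n.+1 -> k) v].

Lemma zopen_neq0 : @zopen (affine n.+1) [set v | v != 0].
Proof.
exists [set p | exists i, p = 'X_i]; apply/seteqP; split=> v /=.
  move=> /negP; rewrite negbK => /eqP -> p [i ->].
  by rewrite /peval mevalXU mxE.
move=> h; apply/negP; rewrite negbK; apply/eqP/rowP => i.
by have := h 'X_i (ex_intro _ i erefl); rewrite /peval mevalXU mxE.
Qed.

Lemma hpt_surj (L : line) : exists2 v, v != 0 & hpt v = L.
Proof.
case: L => L dL; have L0 : L != 0%VS by rewrite -dimv_eq0 (eqP dL).
exists (vpick L); first by rewrite vpick0.
have e : <[vpick L]>%VS = L.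
  by apply/eqP; rewrite eqEdim -memvE memv_pick dim_vline vpick0 L0 (eqP dL).
by apply: val_inj; rewrite val_insubd /= e dL.
Qed.

Lemma proj_openT : proj_open setT.
Proof.
have e : cone setT = [set v : affine n.+1 | v != 0].
  by apply/seteqP; split=> v // -[].
by rewrite /proj_open /= e; exact: zopen_neq0.
Qed.

Lemma proj_openI U V : proj_open U -> proj_open V -> proj_open (U `&` V).
Proof.
rewrite /proj_open /= => oU oV.
have -> : cone (U `&` V) = cone U `&` cone V.
  by apply/seteqP; split=> v => [[? []]|[[? ?] []]].
exact: zopenI.
Qed.

Lemma proj_open_bigcup (F : set (set line)) :
  F `<=` proj_open -> proj_open (\bigcup_(U in F) U).
Proof.
move=> h; apply: zopen_nbhs => v [v0 [U FU Uv]].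
by exists (cone U); split=> [||w [w0 Uw]]; [exact: h|by []|split=> //; exists U].
Qed.

Lemma regular_hpt f (v : affine n.+1) : v != 0 ->
  proj_regular f (hpt v) -> regular (f \o hpt : affine n.+1 -> k) v.
Proof. by move=> v0; exact. Qed.

Lemma proj_regularP f (v : affine n.+1) : v != 0 ->
  regular (f \o hpt : affine n.+1 -> k) v -> proj_regular f (hpt v).
Proof.
move=> v0 [p [q [U [oU Uv h]]]] w w0 ewv.
have hv : <[w]>%VS = <[v]>%VS.
  by have := congr1 val ewv; rewrite !val_insubd !dim_vline v0 w0.
have /vlineP[c wE] : w \in <[v]>%VS by rewrite -hv memv_line.
have c0 : c != 0 by apply: contraNneq w0 => c0; rewrite wE c0 scale0r.
have hZ (u : 'rV[k]_n.+1) : hpt (c^-1 *: u) = hpt u.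
  apply: val_inj; rewrite !val_insubd.
  have -> // : <[c^-1 *: u]>%VS = <[u]>%VS.
  apply: subv_anti; rewrite -!memvE memvZ ?memv_line //=.
  by rewrite -[X in X \in _](scalerKV c0) memvZ// memv_line.
pose sc (r : {mpoly k[n.+1]}) := r \mPo [tuple c^-1 *: 'X_i | i < n.+1].
have scE r (u : 'rV[k]_n.+1) : peval (sc r) u = peval r (c^-1 *: u).
  rewrite /peval /sc comp_mpoly_meval; apply: meval_eq => i.
  by rewrite tnth_map tnth_ord_tuple mevalZ mevalXU mxE.
exists (sc p), (sc q), [set u | U (c^-1 *: u)]; split.
- apply/affine_openP => u Uu.
  have [r [ru rU]] := (affine_openP _).1 oU _ Uu.
  by exists (sc r); rewrite scE; split=> // u'; rewrite scE; exact: rU.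
- by rewrite /= wE scalerK.
- by move=> u Uu; rewrite !scE /= -hZ; exact: h.
Qed.

Lemma proj_regular_open f : proj_open (proj_regular f).
Proof.
rewrite /proj_open /=.
have -> : cone (proj_regular f) =
    [set v : affine n.+1 | v != 0] `&` regular (f \o hpt : affine n.+1 -> k).
  apply/seteqP; split=> v [v0 rv]; split=> //.
    exact: regular_hpt.
  exact: proj_regularP.
apply: zopenI; [exact: zopen_neq0|exact: regular_open].
Qed.

Lemma proj_regular_local (U : set line) f g : proj_open U -> {in U, f =1 g} ->
  U `&` proj_regular f `<=` proj_regular g.
Proof.
move=> oU fg L [UL rf] v v0 vL.
apply: (regular_local oU (f := f \o hpt : affine n.+1 -> k)).
- by split=> //; rewrite vL.
- by move=> w [_ Uw] /=; rewrite fg// inE.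
- exact: rf.
Qed.

Lemma proj_regularC c L : proj_regular (fun=> c) L.
Proof. by move=> v _ _; exact: regularC_of. Qed.

Lemma proj_regularD f g L : proj_regular f L -> proj_regular g L ->
  proj_regular (fun w => f w + g w) L.
Proof. by move=> rf rg v v0 vL; apply: regularD_of; [exact: rf|exact: rg]. Qed.

Lemma proj_regularM f g L : proj_regular f L -> proj_regular g L ->
  proj_regular (fun w => f w * g w) L.
Proof. by move=> rf rg v v0 vL; apply: regularM_of; [exact: rf|exact: rg]. Qed.

Definition proj : kspace k := KSpace (Geometry proj_openT proj_openI
  proj_open_bigcup proj_regular_open proj_regular_local
  proj_regularC proj_regularD proj_regularM).

End Projective.

(* A birational transformation of X is a class of isomorphisms between dense  *)
(* open subsets, modulo agreement on a dense open set.  The values of pfun    *)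
(* outside pdom, and of pinv outside pcod, are irrelevant.                    *)
Record partial_iso X := PartialIso {
  pdom : set X;
  pcod : set X;
  pfun : X -> X;
  pinv : X -> X;
  pdom_open : zopen pdom;
  pcod_open : zopen pcod;
  pdom_dense : zdense pdom;
  pcod_dense : zdense pcod;
  pfun_morphism : morphism_on pdom pfun;
  pinv_morphism : morphism_on pcod pinv;
  pfunP : forall x, pdom x -> pcod (pfun x) /\ pinv (pfun x) = x;
  pinvP : forall y, pcod y -> pdom (pinv y) /\ pfun (pinv y) = y }.

HB.instance Definition _ X := gen_eqMixin (partial_iso X).
HB.instance Definition _ X := gen_choiceMixin (partial_iso X).

Section Bir.
Variable X : kspace k.
Implicit Types f g h : partial_iso X.

Definition bireq f g : Prop := exists W : set X, [/\ zopen W, zdense W &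
  forall x, W x -> [/\ pdom f x, pdom g x & pfun f x = pfun g x]].

Definition bireqb f g : bool := `[< bireq f g >].

Lemma zdenseT : zdense [set: X].
Proof. by move=> O _ [x Ox]; exists x. Qed.

Lemma zdenseI (U V : set X) :
  zopen U -> zdense U -> zdense V -> zdense (U `&` V).
Proof.
move=> oU dU dV O oO O0; rewrite setIA; apply: dV; first exact: zopenI.
exact: dU.
Qed.

Lemma bireq_equiv : equiv_class_of bireqb.
Proof.
split=> [f|f g|g f h].
- by apply/asboolP; exists (pdom f); split=> //; [exact: pdom_open|exact: pdom_dense].
- suff sym u v : bireq u v -> bireq v u.
    by apply/asboolP/asboolP; exact: sym.
  by move=> [W [oW dW h]]; exists W; split=> // x /h[].
- move=> /asboolP[W [oW dW h1]] /asboolP[W' [oW' dW' h2]]; apply/asboolP.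
  exists (W `&` W'); split; [exact: zopenI|exact: zdenseI|].
  by move=> x [/h1[? ? ->] /h2[]].
Qed.

Canonical bireq_rel := EquivRelPack bireq_equiv.

Definition bir := {eq_quot bireq_rel}.

HB.instance Definition _ := EqQuotient.on bir.
HB.instance Definition _ := Choice.on bir.

Lemma bir_eqP f g : \pi_bir f = \pi_bir g <-> bireq f g.
Proof.
split=> [/eqmodP e|e]; first exact/asboolP.
by apply/eqmodP; exact/asboolP.
Qed.

Lemma morphism_at_id (x : X) : morphism_at (@id X) x.
Proof.
by split=> [V oV Vx|g rg]; [exists V; split=> // y Vy|exact: rg].
Qed.

Lemma morphism_at_comp (Y Z T : kspace k) (u : Z -> T) (v : Y -> Z) (y : Y) :
  morphism_at v y -> morphism_at u (v y) -> morphism_at (u \o v) y.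
Proof.
move=> [cv rv] [cu ru]; split=> [V oV Vy|w rw]; last exact: (rv _ (ru _ rw)).
have [U [oU Uv UV]] := cu _ oV Vy; have [U' [oU' Uy' U'U]] := cv _ oU Uv.
by exists U'; split=> // z /U'U /UV.
Qed.

Lemma preimage_open (Y : kspace k) (D : set X) (u : X -> Y) (V : set Y) :
  zopen D -> morphism_on D u -> zopen V -> zopen (D `&` u @^-1` V).
Proof.
move=> oD mu oV; apply: zopen_nbhs => x [Dx Vx].
have [U [oU Ux UV]] := (mu _ Dx).1 _ oV Vx.
exists (D `&` U); split; [exact: zopenI|by []|].
by move=> y [Dy /UV].
Qed.

Definition pid : partial_iso X.
Proof.
by refine (@PartialIso X setT setT id id (zopenT X) (zopenT X) zdenseT zdenseT
  (fun x _ => morphism_at_id x) (fun x _ => morphism_at_id x) _ _).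
Defined.

Definition pinverse f : partial_iso X :=
  PartialIso (pcod_open f) (pdom_open f) (pcod_dense f)
    (pdom_dense f) (@pinv_morphism _ f) (@pfun_morphism _ f)
    (@pinvP _ f) (@pfunP _ f).

Lemma pdom_comp_dense f (D : set X) : zopen D -> zdense D ->
  zdense (pdom f `&` pfun f @^-1` D).
Proof.
move=> oD dD O oO O0.
have [x [Ox fx]] := pdom_dense f oO O0.
have oO' : zopen (pcod f `&` pinv f @^-1` (O `&` pdom f)).
  apply: preimage_open; [exact: pcod_open|exact: pinv_morphism|].
  by apply: zopenI => //; exact: pdom_open.
have [|y [[cy /= [Oy dy]] Dy]] := dD _ oO'.
  have [cfx e] := pfunP fx; exists (pfun f x); split=> //=.
  by rewrite e.
exists (pinv f y); split=> //; split=> //=.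
by have [_ ->] := pinvP cy.
Qed.

Definition pcomp f g : partial_iso X.
Proof.
refine (@PartialIso X (pdom g `&` pfun g @^-1` pdom f)
  (pcod f `&` pinv f @^-1` pcod g) (pfun f \o pfun g) (pinv g \o pinv f)
  _ _ _ _ _ _ _ _).
- apply: preimage_open; [exact: pdom_open|exact: pfun_morphism|exact: pdom_open].
- apply: preimage_open; [exact: pcod_open|exact: pinv_morphism|exact: pcod_open].
- by apply: pdom_comp_dense; [exact: pdom_open|exact: pdom_dense].
- exact: (@pdom_comp_dense (pinverse f) _ (pcod_open g) (pcod_dense g)).
- by move=> x [gx fx]; apply: morphism_at_comp; exact: pfun_morphism.
- by move=> x [gx fx]; apply: morphism_at_comp; exact: pinv_morphism.
- move=> x [gx fx] /=; have [cg eg] := pfunP gx; have [cf ef] := pfunP fx.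
  by rewrite /= ef eg; split=> //; split=> //=; rewrite ef.
- move=> x [fx gx] /=; have [cf ef] := pinvP fx; have [cg eg] := pinvP gx.
  by rewrite /= eg ef; split=> //; split=> //=; rewrite eg.
Defined.

(* The product is composition: [f * g] is x |-> f (g x). *)
Definition bir_mul (a b : bir) : bir := \pi_bir (pcomp (repr a) (repr b)).
Definition bir_one : bir := \pi_bir pid.
Definition bir_inv (a : bir) : bir := \pi_bir (pinverse (repr a)).

Lemma repr_bireq f : bireq (repr (\pi_bir f)) f.
Proof. by apply/bir_eqP; rewrite reprK. Qed.

Lemma bireq_comp f f' g g' :
  bireq f f' -> bireq g g' -> bireq (pcomp f g) (pcomp f' g').
Proof.
move=> [W [oW dW h]] [W' [oW' dW' h']].
exists (W' `&` (pdom g `&` pfun g @^-1` W)); split.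
- apply: zopenI => //.
  apply: preimage_open => //; [exact: pdom_open|exact: pfun_morphism].
- by apply: zdenseI => //; exact: pdom_comp_dense.
- move=> x [/h'[gx gx' e'] [_ /h[fx fx' e]]] /=.
  by rewrite /= -e' e; split.
Qed.

Lemma bireq_of_eq f g : pdom f = pdom g ->
  (forall x, pdom f x -> pfun f x = pfun g x) -> bireq f g.
Proof.
move=> d e; exists (pdom f); split; [exact: pdom_open|exact: pdom_dense|].
by move=> x fx; split=> //; [rewrite -d|exact: e].
Qed.

Lemma bireq_refl f : bireq f f. Proof. exact: bireq_of_eq. Qed.

Lemma bireq_trans f g h : bireq f g -> bireq g h -> bireq f h.
Proof. by move=> /bir_eqP e /bir_eqP e'; apply/bir_eqP; rewrite e. Qed.

Lemma bireq_sym f g : bireq f g -> bireq g f.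
Proof. by move=> /bir_eqP e; apply/bir_eqP. Qed.

Lemma bir_mulA : associative bir_mul.
Proof.
move=> a b c; apply/bir_eqP.
apply: (@bireq_trans _ (pcomp (repr a) (pcomp (repr b) (repr c)))).
  apply: bireq_comp (repr_bireq _); exact: bireq_refl.
apply: (@bireq_trans _ (pcomp (pcomp (repr a) (repr b)) (repr c))).
  by apply: bireq_of_eq => //=; apply/seteqP; split=> x [] => [[]|? []].
apply: bireq_comp (bireq_refl _); exact/bireq_sym/repr_bireq.
Qed.

Lemma bir_mul1 : left_id bir_one bir_mul.
Proof.
move=> a; rewrite -[RHS]reprK; apply/bir_eqP.
apply: (@bireq_trans _ (pcomp pid (repr a))).
  exact: bireq_comp (repr_bireq _) (bireq_refl _).
by apply: bireq_of_eq => //=; apply/seteqP; split=> x // -[].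
Qed.

Lemma bir_mulr1 : right_id bir_one bir_mul.
Proof.
move=> a; rewrite -[RHS]reprK; apply/bir_eqP.
apply: (@bireq_trans _ (pcomp (repr a) pid)).
  exact: bireq_comp (bireq_refl _) (repr_bireq _).
by apply: bireq_of_eq => //=; apply/seteqP; split=> x // -[].
Qed.

Lemma pcompV f : bireq (pcomp (pinverse f) f) pid.
Proof.
exists (pdom f); split; [exact: pdom_open|exact: pdom_dense|move=> x fx].
by have [? e] := pfunP fx; split=> //=.
Qed.

Lemma bir_mulV : left_inverse bir_one bir_inv bir_mul.
Proof.
move=> a; apply/bir_eqP; apply: bireq_trans (pcompV (repr a)).
exact: bireq_comp (repr_bireq _) (bireq_refl _).
Qed.

Lemma bir_mulrV : right_inverse bir_one bir_inv bir_mul.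
Proof.
move=> a; apply/bir_eqP; apply: bireq_trans (pcompV (pinverse (repr a))).
apply: (@bireq_trans _ (pcomp (repr a) (pinverse (repr a)))).
  exact: bireq_comp (bireq_refl _) (repr_bireq _).
exact: bireq_of_eq.
Qed.

HB.instance Definition _ :=
  isGroup.Build bir bir_mulA bir_mul1 bir_mulr1 bir_mulV bir_mulrV.

(* The birational transformation b is defined at x with value y, by the       *)
(* representative chosen for b; all uses below are for x in a dense open set, *)
(* and do not depend on this choice.                                          *)
Definition sends (b : bir) (x y : X) := pdom (repr b) x /\ pfun (repr b) x = y.

(* [F] is the isomorphism U -> V over A induced by the A-birational map; it   *)
(* determines that map since A x X is irreducible.                            *)
Definition bir_morphism (A : kspace k) (mu : A -> bir) :=
  exists (U V : set (sprod A X)) (F F' : sprod A X -> sprod A X),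
    [/\ zopen U /\ zopen V,
        (forall a, exists w, U (a, w)) /\ (forall a, exists w, V (a, w)),
        morphism_on U F /\ morphism_on V F',
        (forall z, U z -> [/\ V (F z), F' (F z) = z & (F z).1 = z.1]) /\
        (forall z, V z -> U (F' z) /\ F (F' z) = z) &
        forall a, exists W : set X, [/\ zopen W, zdense W &
          forall w, W w -> U (a, w) /\ sends (mu a) w (F (a, w)).2]].

Definition bir_closed (S : set bir) :=
  forall A : kspace k, variety A -> irreducible A ->
  forall mu : A -> bir, bir_morphism mu -> zclosed (mu @^-1` S).

Definition subgroup (G : set bir) :=
  [/\ G 1%g, forall a b, G a -> G b -> G (a * b)%g & forall a, G a -> G a^-1%g].

End Bir.

Record group_space := GroupSpace {
  gs_group :> groupType;
  gs_geom : geometry k gs_group }.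

Definition space_of (K : group_space) : kspace k := KSpace (gs_geom K).

Definition algebraic_group (K : group_space) :=
  [/\ variety (space_of K),
      @morphism (sprod (space_of K) (space_of K)) (space_of K)
        (fun z => z.1 * z.2)%g &
      @morphism (space_of K) (space_of K) (fun x => x^-1%g)].

Definition group_isomorphic (K L : group_space) :=
  exists u : K -> L, {morph u : x y / (x * y)%g} /\
    @isomorphism (space_of K) (space_of L) u.

(* u induces an isomorphism of algebraic groups K -> H, where the subgroup H  *)
(* of L has the geometry induced by L.                                        *)
Definition induces_group_isomorphism (K L : group_space) (u : K -> L)
    (H : set L) :=
  {morph u : x y / (x * y)%g} /\
  exists w : space_of K -> @sub (space_of L) H,
    (forall x, val (w x) = u x) /\ isomorphism w.

(* phi : K -> G transports to the subgroup G of Bir(X) its natural structure  *)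
(* of algebraic group: the morphisms A -> Bir(X) with values in G are the     *)
(* morphisms of varieties from A to K.                                        *)
Definition natural_structure X (G : set (bir X)) (K : group_space)
    (phi : K -> bir X) :=
  [/\ algebraic_group K,
      {morph phi : x y / (x * y)%g},
      injective phi,
      range phi = G &
      forall A : kspace k, variety A -> irreducible A ->
        forall h : A -> space_of K, morphism h <-> bir_morphism (phi \o h)].

Definition Gm_pt := {x : k | x != 0}.
HB.instance Definition _ := Choice.on Gm_pt.

Definition Gm_mul (x y : Gm_pt) : Gm_pt :=
  exist _ (val x * val y) (mulf_neq0 (valP x) (valP y)).
Definition Gm_one : Gm_pt := exist _ 1 (oner_neq0 k).
Fact Gm_inv_subproof (x : Gm_pt) : (val x)^-1 != 0.
Proof. by rewrite invr_eq0 (valP x). Qed.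
Definition Gm_inv (x : Gm_pt) : Gm_pt := exist _ (val x)^-1 (Gm_inv_subproof x).

Lemma Gm_mulA : associative Gm_mul.
Proof. by move=> x y z; apply: val_inj; rewrite /= mulrA. Qed.
Lemma Gm_mul1 : left_id Gm_one Gm_mul.
Proof. by move=> x; apply: val_inj; rewrite /= mul1r. Qed.
Lemma Gm_mulr1 : right_id Gm_one Gm_mul.
Proof. by move=> x; apply: val_inj; rewrite /= mulr1. Qed.
Lemma Gm_mulV : left_inverse Gm_one Gm_inv Gm_mul.
Proof. by move=> x; apply: val_inj; rewrite /= mulVf ?(valP x). Qed.
Lemma Gm_mulrV : right_inverse Gm_one Gm_inv Gm_mul.
Proof. by move=> x; apply: val_inj; rewrite /= mulfV ?(valP x). Qed.

HB.instance Definition _ :=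
  isGroup.Build Gm_pt Gm_mulA Gm_mul1 Gm_mulr1 Gm_mulV Gm_mulrV.

Definition Gm : group_space := @GroupSpace Gm_pt
  (@induced Gm_pt (affine 1) (fun x => \row_(i < 1) val x)).

(* (a, b) stands for y |-> a y + b. *)
Definition Aff1_pt := {p : k * k | p.1 != 0}.
HB.instance Definition _ := Choice.on Aff1_pt.

Definition Aff1_mul (s t : Aff1_pt) : Aff1_pt :=
  exist (fun p : k * k => p.1 != 0)
    ((val s).1 * (val t).1, (val s).1 * (val t).2 + (val s).2)
    (mulf_neq0 (valP s) (valP t)).
Definition Aff1_one : Aff1_pt :=
  exist (fun p : k * k => p.1 != 0) (1, 0) (oner_neq0 k).
Fact Aff1_inv_subproof (t : Aff1_pt) : (val t).1^-1 != 0.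
Proof. by rewrite invr_eq0 (valP t). Qed.
Definition Aff1_inv (t : Aff1_pt) : Aff1_pt :=
  exist (fun p : k * k => p.1 != 0)
    ((val t).1^-1, - ((val t).1^-1 * (val t).2)) (Aff1_inv_subproof t).

Lemma Aff1_mulA : associative Aff1_mul.
Proof. by move=> r s t; apply: val_inj; rewrite /= !mulrA mulrDr mulrA addrA. Qed.
Lemma Aff1_mul1 : left_id Aff1_one Aff1_mul.
Proof. by case=> -[a b] h; apply: val_inj; rewrite /= !mul1r addr0. Qed.
Lemma Aff1_mulr1 : right_id Aff1_one Aff1_mul.
Proof. by case=> -[a b] h; apply: val_inj; rewrite /= mulr1 mulr0 add0r. Qed.
Lemma Aff1_mulV : left_inverse Aff1_one Aff1_inv Aff1_mul.
Proof.
by case=> -[a b] h; apply: val_inj; rewrite /= mulVf// addrN.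
Qed.
Lemma Aff1_mulrV : right_inverse Aff1_one Aff1_inv Aff1_mul.
Proof.
by case=> -[a b] h; apply: val_inj; rewrite /= mulfV// mulrN mulVKf// addNr.
Qed.

HB.instance Definition _ :=
  isGroup.Build Aff1_pt Aff1_mulA Aff1_mul1 Aff1_mulr1 Aff1_mulV Aff1_mulrV.

Definition Aff1 : group_space := @GroupSpace Aff1_pt
  (@induced Aff1_pt (affine 2)
     (fun t => \row_(i < 2) [:: (val t).1; (val t).2]`_i)).

Local Notation P2 := (proj 2).

Definition ratio3 (x y z : k) : P2 := hpt (\row_(i < 3) [:: x; y; z]`_i).

Definition bir_degree (f : bir P2) (d : nat) :=
  exists P : 'I_3 -> {mpoly k[3]},
    [/\ forall i, P i \is d.-homog,
        forall q : {mpoly k[3]}, (forall i, exists r, P i = q * r) ->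
          exists c : k, q = c%:MP &
        exists W : set P2, [/\ zopen W, zdense W &
          forall v, v != 0 -> W (hpt v) ->
            \row_i peval (P i) v != 0 /\
            sends f (hpt v) (hpt (\row_i peval (P i) v))]].

Definition bounded_degree (G : set (bir P2)) :=
  exists D : nat, forall f, G f -> exists2 d, (d <= D)%N & bir_degree f d.

Definition algebraic_subgroup (G : set (bir P2)) :=
  [/\ subgroup G, bir_closed G & bounded_degree G].

(* f is the transformation (x, y) |-> (u x y).1, (u x y).2 of the affine      *)
(* plane, embedded by (x, y) |-> [x : y : 1].                                 *)
Definition affine_form (f : bir P2) (u : k -> k -> k * k) :=
  exists W : set P2, [/\ zopen W, zdense W &
    forall x y, W (ratio3 x y 1) ->
      sends f (ratio3 x y 1) (ratio3 (u x y).1 (u x y).2 1)].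

Definition T01 : set (bir P2) :=
  [set f | exists2 t : k, t != 0 & affine_form f (fun x y => (x, t * y))].

(* Value of a rational function, correct outside the finitely many zeros of   *)
(* the denominator of the chosen fraction.                                    *)
Definition rat_eval (r : {fraction {poly k}}) (y : k) : k :=
  (\n_(repr r)).[y] / (\d_(repr r)).[y].

Definition jonquieres_form (f : bir P2) (M : 'M[{fraction {poly k}}]_2)
    (t : Aff1) :=
  affine_form f (fun x y =>
    ((rat_eval (M 0 0) y * x + rat_eval (M 0 1) y) /
     (rat_eval (M 1 0) y * x + rat_eval (M 1 1) y),
     (val t).1 * y + (val t).2)).

(* PGL_2(C(y)) >< Aff_1; a class in PGL_2(C(y)) is given by any of its        *)
(* matrices.                                                                  *)
Definition PGL2_Aff1 : set (bir P2) :=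
  [set f | exists2 M, M \in unitmx & exists t, jonquieres_form f M t].

(* pr_2; t is determined by f in PGL2_Aff1. *)
Definition pr2 (f : bir P2) : Aff1 :=
  xget 1%g [set t | exists2 M, M \in unitmx & jonquieres_form f M t].

End Spaces.

Notation P2 k := (proj k 2).

(* Main.v *)
Require Import Defs.
From HB Require Import structures.
From mathcomp Require Import all_boot all_fingroup all_algebra.
From mathcomp Require Import generic_quotient fraction.
From mathcomp Require Import mpoly.
From mathcomp Require Import boolp classical_sets reals.
From mathcomp Require Import complex.
From mathcomp Require Import ring.

(* Suppose that pr_2 is an isomorphism on G.  A one-dimensional torus in Aff_1
   fixes a point c, so G = {f_t} with f_t acting on the base as
   y |-> t y + c (1 - t).  The orbits of three points of a general fibre are
   then rational curves, sections x = rho_i(y) of the projection to the base,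
   that are invariant under all f_t.  A transformation g of PGL_2(C(y)) x| Aff_1
   that sends the sections 0, 1, infinity to the rho_i conjugates (x, t y) to
   f_t, because a homography is determined by three values.
     Conversely, if G = g T_{0,1} g^-1, then t |-> g (x, t y) g^-1 is a family
   parametrised by G, hence an injective endomorphism of G_m, which has to be
   t |-> t or t |-> t^-1; so pr_2 is t |-> (t^+-1, c (1 - t^+-1)) on G. *)

Set Implicit Arguments.
Unset Strict Implicit.
Unset Printing Implicit Defensive.

Import GRing.Theory.

Local Open Scope quotient_scope.
Local Open Scope classical_set_scope.
Local Open Scope ring_scope.

(** Both assertions are compared with a normal form: an isomorphism s |-> f_s from G_m to G such
    that f_s acts on the base by y |-> s y + c (1 - s). The natural structure of G serves in two
    directions. The identity of K is a morphism, so the elements of G form an algebraic family and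
    an orbit s |-> f_s(p) has rational coordinates; and a family with values in G is a morphism to
    K, which makes the reparametrisation in the converse algebraic. An orbit is a section because,
    for p over c + d with d nonzero, f_s(p) lies over c + d s: up to the affine change y = d s + c,
    the parameter s is the coordinate of the base. The three points are taken in one fibre so that
    their sections share this parameter. The obstacle is that a birational map is known only
    generically, while an orbit is a curve that may avoid the dense open set where a formula holds.
    Formulas are therefore extended to the whole domain of the family by the identity principle for
    regular functions, and the conjugation relation, at first valid for all but finitely many s, is
    extended by the group law. *)

Section Spaces.
Variable k : fieldType.
Implicit Types X Y Z : kspace k.

(* [geometry] does not require that nonvanishing regular functions have open
   support and regular inverses; all the spaces built from affine ones do. *)
Definition local_units X := forall f : X -> k,
  @zopen k X [set x | regular f x /\ f x != 0] /\
  forall x, regular f x -> f x != 0 -> @regular k X (fun y => (f y)^-1) x.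

Lemma local_units_affine n : local_units (affine k n).
Proof.
move=> f; split=> [|v [p [q [U [oU Uv h]]]] fv].
  apply: zopen_nbhs => v [[p [q [U [oU Uv h]]]] fv].
  exists (U `&` [set w | peval p w != 0]); split.
  - apply: affine_openI => //; apply/affine_openP => w pw.
    by exists p; split.
  - split=> //=; apply: contraNneq fv => pv.
    by have [_ ->] := h _ Uv; rewrite pv mul0r.
  - move=> w [Uw /= pw]; have [qw fw] := h _ Uw; split.
      by exists p, q, U.
    by rewrite fw mulf_neq0 // invr_eq0.
exists q, p, (U `&` [set w | peval p w != 0]); split.
- apply: affine_openI => //; apply/affine_openP => w pw.
  by exists p; split.
- split=> //=; apply: contraNneq fv => pv.
  by have [_ ->] := h _ Uv; rewrite pv mul0r.
- move=> w [Uw /= pw]; have [qw fw] := h _ Uw; split=> //.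
  by rewrite fw invf_div.
Qed.

Lemma local_units_induced (T : Type) X (j : T -> X) : local_units X ->
  local_units (KSpace (induced j)).
Proof.
move=> lX f; split=> [|t [O [g [oO Ot rg fg]]] ft].
  apply: zopen_nbhs => t [[O [g [oO Ot rg fg]]] ft].
  exists (j @^-1` (O `&` [set x | regular g x /\ g x != 0])); split.
  - exists (O `&` [set x | regular g x /\ g x != 0]) => //.
    by apply: zopenI => //; have [] := lX g.
  - by split=> //; split=> //; rewrite -fg.
  - move=> s [Os [rs gs]]; split; last by rewrite fg.
    by exists O, g.
exists O, (fun x => (g x)^-1); split=> //.
- by have [_] := lX g; apply => //; rewrite -fg.
- by move=> s Os; rewrite fg.
Qed.

Lemma local_units_sub X (H : set X) : local_units X -> local_units (sub H).
Proof. exact: local_units_induced. Qed.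

Lemma local_units_sprod X Y : local_units (sprod X Y).
Proof.
move=> f; split=> [|z [U [V [p [q [oUV UVz [tp tq] qz e]]]]] fz].
  move=> z [[U [V [p [q [oUV UVz [tp tq] qz e]]]]] fz].
  have pz : p z != 0.
    by apply: contraNneq fz => pz; rewrite e ?pz ?mul0r //; case: UVz.
  exists U, V, (fun z => p z * q z); split=> //.
  - exact: tensorM.
  - by rewrite mulf_neq0.
  - move=> z' Uz' Vz'; rewrite mulf_eq0 negb_or => /andP[pz' qz']; split.
      by exists U, V, p, q.
    by rewrite e // mulf_neq0 // invr_eq0.
have [Uz Vz] := UVz.
have pz : p z != 0.
  by apply: contraNneq fz => pz; rewrite e ?pz ?mul0r.
(* The inverse q / p is written q^2 / (p q), so that a nonzero denominator also ensures q != 0,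
   where f = p / q is known. *)
exists U, V, (fun z => q z * q z), (fun z => p z * q z); split=> //.
- by split; exact: tensorM.
- by rewrite mulf_neq0.
- move=> z' Uz' Vz'; rewrite mulf_eq0 negb_or => /andP[pz' qz'].
  by rewrite e // invf_div -mulf_div divff ?mulr1.
Qed.

Lemma local_units_proj n : local_units (proj k n).
Proof.
move=> f; split=> [|L rL fL v v0 vL].
  have e : @cone k n [set x | @regular k (proj k n) f x /\ f x != 0] =
      [set v : affine k n.+1 | v != 0] `&`
      [set v | @regular k (affine k n.+1) (f \o @hpt k n) v /\ (f \o @hpt k n) v != 0].
    apply/seteqP; split=> v [v0 [rv fv]]; split=> //; split=> //.
      exact: regular_hpt.
    exact: proj_regularP.
  suff : @zopen k (affine k n.+1) (@cone k n
    [set x | @regular k (proj k n) f x /\ f x != 0]) by [].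
  rewrite e; apply: zopenI; first exact: zopen_neq0.
  by have [] := local_units_affine (f \o @hpt k n).
have [_ h] := local_units_affine (f \o @hpt k n).
apply: (h v); last by rewrite /= vL.
by apply: regular_hpt => //; rewrite vL.
Qed.

(** * Regular functions and morphisms *)

Lemma morphism_at_cst X Y (c : Y) (x : X) : morphism_at (fun=> c) x.
Proof.
split=> [V oV Vc|g rg]; first by exists setT; split=> //; exact: zopenT.
exact: regularC_of.
Qed.

Lemma regularC X c (x : X) : @regular k X (fun=> c) x.
Proof. exact: regularC_of. Qed.

Lemma regularD X (f g : X -> k) x : regular f x -> regular g x ->
  @regular k X (fun y => f y + g y) x.
Proof. exact: regularD_of. Qed.

Lemma regularM X (f g : X -> k) x : regular f x -> regular g x ->
  @regular k X (fun y => f y * g y) x.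
Proof. exact: regularM_of. Qed.

Lemma regularN X (f : X -> k) x : regular f x -> @regular k X (fun y => - f y) x.
Proof.
move=> rf; apply: (regular_local (zopenT X) (f := fun y => -1 * f y)) => //.
  by move=> y _; rewrite mulN1r.
by apply: regularM => //; exact: regularC.
Qed.

Lemma regularB X (f g : X -> k) x : regular f x -> regular g x ->
  @regular k X (fun y => f y - g y) x.
Proof. by move=> rf rg; apply: regularD => //; exact: regularN. Qed.

Lemma regular_div X (f g : X -> k) x : local_units X ->
  regular f x -> regular g x -> g x != 0 -> @regular k X (fun y => f y / g y) x.
Proof.
move=> lX rf rg gx; apply: regularM => //.
by have [_] := lX g; apply.
Qed.

Lemma regular_sum X (I : Type) (r : seq I) (P : pred I) (F : I -> X -> k) x :
  (forall i, regular (F i) x) ->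
  @regular k X (fun y => \sum_(i <- r | P i) F i y) x.
Proof.
move=> rF; elim: r => [|i r IH].
  apply: (regular_local (zopenT X) (f := fun=> 0)) => // [y _|].
    by rewrite big_nil.
  exact: regularC.
apply: (regular_local (zopenT X) (f := fun y =>
  (if P i then F i y else 0) + \sum_(i <- r | P i) F i y)) => // [y _|].
  by rewrite big_cons; case: (P i); rewrite ?add0r.
apply: regularD => //; case: (P i); [exact: rF|exact: regularC].
Qed.

Lemma regular_prod X (I : Type) (r : seq I) (P : pred I) (F : I -> X -> k) x :
  (forall i, regular (F i) x) ->
  @regular k X (fun y => \prod_(i <- r | P i) F i y) x.
Proof.
move=> rF; elim: r => [|i r IH].
  apply: (regular_local (zopenT X) (f := fun=> 1)) => // [y _|].
    by rewrite big_nil.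
  exact: regularC.
apply: (regular_local (zopenT X) (f := fun y =>
  (if P i then F i y else 1) * \prod_(i <- r | P i) F i y)) => // [y _|].
  by rewrite big_cons; case: (P i); rewrite ?mul1r.
apply: regularM => //; case: (P i); [exact: rF|exact: regularC].
Qed.

Lemma regular_exp X (f : X -> k) n x : regular f x ->
  @regular k X (fun y => f y ^+ n) x.
Proof.
move=> rf; apply: (regular_local (zopenT X) (f := fun y => \prod_(i < n) f y)) => //.
  by move=> y _; rewrite prodr_const card_ord.
exact: regular_prod.
Qed.

Lemma regular_horner X (p : {poly k}) (f : X -> k) x : regular f x ->
  @regular k X (fun y => p.[f y]) x.
Proof.
move=> rf; apply: (regular_local (zopenT X)
  (f := fun y => \sum_(i < size p) p`_i * f y ^+ i)) => //.
  by move=> y _; rewrite horner_coef.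
apply: regular_sum => i; apply: regularM; first exact: regularC.
exact: regular_exp.
Qed.

Lemma regular_peval X n (p : {mpoly k[n]}) (f : X -> 'rV[k]_n) x :
  (forall i, @regular k X (fun y => f y ord0 i) x) ->
  @regular k X (fun y => peval p (f y)) x.
Proof.
move=> rf; apply: (regular_local (zopenT X)
  (f := fun y => \sum_(m <- msupp p) p@_m * \prod_i f y ord0 i ^+ m i)) => //.
apply: regular_sum => m; apply: regularM; first exact: regularC.
by apply: regular_prod => i; exact: regular_exp.
Qed.

Lemma zopen_regular_neq0 X (U : set X) (f : X -> k) : local_units X -> zopen U ->
  (forall x, U x -> regular f x) -> zopen (U `&` [set x | f x != 0]).
Proof.
move=> lX oU rf.
have -> : U `&` [set x | f x != 0] = U `&` [set x | regular f x /\ f x != 0].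
  apply/seteqP; split=> x [Ux]; first by move=> fx; split=> //; split=> //; exact: rf.
  by move=> [].
by apply: zopenI => //; have [] := lX f.
Qed.

Lemma morphism_at_affine X n (f : X -> affine k n) x : local_units X ->
  (forall i, @regular k X (fun y => f y ord0 i) x) -> morphism_at f x.
Proof.
move=> lX rf; split=> [V /affine_openP oV Vx|g [p [q [U [oU Ux h]]]]].
  have [p [px pV]] := oV _ Vx.
  exists [set y | @regular k X (fun y => peval p (f y)) y /\ peval p (f y) != 0].
  split; [by have [] := lX (fun y => peval p (f y))| |by move=> y [_ /pV]].
  by split=> //; exact: regular_peval.
move/affine_openP: oU => oU; have [r [rx rU]] := oU _ Ux.
have [qx _] := h _ Ux.
apply: (regular_local (U := [set y | @regular k X (fun y => peval r (f y)) y
    /\ peval r (f y) != 0]) (f := fun y => peval p (f y) / peval q (f y))).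
- by have [] := lX (fun y => peval r (f y)).
- by split=> //; exact: regular_peval.
- by move=> y [_ /rU Uy] /=; have [_ ->] := h _ Uy.
- by apply: regular_div => //; exact: regular_peval.
Qed.

Lemma morphism_at_induced (T : Type) X Y (j : T -> X) (f : Y -> KSpace (induced j)) y :
  @morphism_at k Y X (j \o f) y -> morphism_at f y.
Proof.
move=> [cf rf]; split=> [V [O oO ->] Oy|g [O [h [oO Oy rh gh]]]].
  exact: cf oO Oy.
have [U [oU Uy UO]] := cf _ oO Oy.
apply: (regular_local oU Uy (f := h \o (j \o f))).
  by move=> z /UO /= Oz; rewrite /= gh.
exact: rf.
Qed.

Lemma morphism_at_val (T : Type) X (j : T -> X) t :
  @morphism_at k (KSpace (induced j)) X j t.
Proof.
split=> [V oV Vt|g rg]; first by exists (j @^-1` V); split=> //; exists V.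
by exists setT, g; split=> //; exact: zopenT.
Qed.

Lemma morphism_at_hpt n (v : affine k n.+1) : v != 0 ->
  @morphism_at k (affine k n.+1) (proj k n) (@hpt k n) v.
Proof.
move=> v0; split=> [V oV Vv|g rg]; last exact: rg.
by exists (cone V); split=> // w [].
Qed.

Lemma morphism_at_fst X Y (z : X * Y) : @morphism_at k (sprod X Y) X fst z.
Proof.
split=> [V oV Vz|g rg].
  exists (fst @^-1` V); split=> // z' Vz'.
  exists V, setT, (fun=> 1); split=> //.
  - by split=> //; exact: zopenT.
  - exact: tensorC.
  - exact: oner_neq0.
exists (regular g), setT, (fun z => g z.1), (fun=> 1); split=> //.
- by split; [exact: regular_open|exact: zopenT].
- split; last exact: tensorC.
  exists unit, (fun=> g), (fun=> fun=> 1); split=> [i y //|i y _|z' _ _].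
    exact: regularC.
  by rewrite (big_pred1 tt) ?mulr1// => -[].
- exact: oner_neq0.
- by move=> z' _ _ _ /=; rewrite divr1.
Qed.

Lemma morphism_at_snd X Y (z : X * Y) : @morphism_at k (sprod X Y) Y snd z.
Proof.
split=> [V oV Vz|g rg].
  exists (snd @^-1` V); split=> // z' Vz'.
  exists setT, V, (fun=> 1); split=> //.
  - by split=> //; exact: zopenT.
  - exact: tensorC.
  - exact: oner_neq0.
exists setT, (regular g), (fun z => g z.2), (fun=> 1); split=> //.
- by split; [exact: zopenT|exact: regular_open].
- split; last exact: tensorC.
  exists unit, (fun=> fun=> 1), (fun=> g); split=> [i y _|i y //|z' _ _].
    exact: regularC.
  by rewrite (big_pred1 tt) ?mul1r// => -[].
- exact: oner_neq0.
- by move=> z' _ _ _ /=; rewrite divr1.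
Qed.

(** Open sets of the product are cut out by nonvanishing tensors. A tensor pulls back to a finite
    sum of products of regular functions, and [local_units] makes its nonvanishing locus open and
    its inverse regular. *)
Lemma morphism_at_pair X Y Z (f : X -> Y) (g : X -> Z) x : local_units X ->
  morphism_at f x -> morphism_at g x ->
  @morphism_at k X (sprod Y Z) (fun y => (f y, g y)) x.
Proof.
move=> lX [cf rf] [cg rg].
have tens (U : set Y) (V : set Z) h : zopen U -> zopen V -> U (f x) -> V (g x) ->
    tensor U V h -> exists O : set X, [/\ zopen O, O x,
      (forall y, O y -> U (f y) /\ V (g y)) &
      @regular k X (fun y => h (f y, g y)) x].
  move=> oU oV Ux Vx [I [a [b [ra rb e]]]].
  have [O1 [oO1 O1x O1U]] := cf _ oU Ux; have [O2 [oO2 O2x O2V]] := cg _ oV Vx.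
  have oO := zopenI oO1 oO2; exists (O1 `&` O2); split=> //.
    by move=> y [/O1U ? /O2V ?].
  apply: (regular_local oO (f := fun y => \sum_i a i (f y) * b i (g y))) => //.
    by move=> y [/O1U ? /O2V ?]; rewrite e.
  apply: regular_sum => i; apply: regularM.
    by apply: rf; exact: ra.
  by apply: rg; exact: rb.
split=> [W /(_ (f x, g x)) oW Wx|h].
  have [U [V [h [[oU oV] [Ux Vx] th hx hW]]]] := oW Wx.
  have [O [oO Ox OUV rh]] := tens _ _ _ oU oV Ux Vx th.
  exists (O `&` [set y | @regular k X (fun y => h (f y, g y)) y /\ h (f y, g y) != 0]).
  split=> //; first by apply: zopenI => //; have [] := lX (fun y => h (f y, g y)).
  by move=> y [/OUV[Uy Vy] [_ hy]]; exact: hW.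
move=> [U [V [p [q [[oU oV] [Ux Vx] [tp tq] qx e]]]]].
have [O [oO Ox OUV rp]] := tens _ _ _ oU oV Ux Vx tp.
have [_ [_ _ _ rq]] := tens _ _ _ oU oV Ux Vx tq.
apply: (regular_local (U := O `&` [set y | @regular k X (fun y => q (f y, g y)) y
   /\ q (f y, g y) != 0]) (f := fun y => p (f y, g y) / q (f y, g y))) => //.
- by apply: zopenI => //; have [] := lX (fun y => q (f y, g y)).
- by move=> y [/OUV[Uy Vy] [_ qy]] /=; rewrite e.
- exact: regular_div.
Qed.

Lemma zopen_preimage X Y (D : set X) (u : X -> Y) (V : set Y) :
  zopen D -> (forall x, D x -> morphism_at u x) -> zopen V ->
  zopen [set x | D x /\ V (u x)].
Proof. exact: preimage_open. Qed.

(** Identity principle: if f - g were nonzero at x, it would be nonzero on a neighbourhood of x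
    inside O, and this neighbourhood meets D. *)
Lemma regular_eq_dense X (D O : set X) (f g : X -> k) x : local_units X ->
  zdense D -> zopen O -> O x -> regular f x -> regular g x ->
  (forall y, O y -> D y -> f y = g y) -> f x = g x.
Proof.
move=> lX dD oO Ox rf rg fg; apply/eqP; rewrite -subr_eq0; apply: contraT => fgx.
pose h y := f y - g y; have [oh _] := lX h.
have [|y [[Oy [_ hy]] Dy]] := dD _ (zopenI oO oh).
  by exists x; split=> //; split=> //; exact: regularB.
by rewrite /h (fg y) // subrr eqxx in hy.
Qed.

End Spaces.

(** * Polynomials and the Zariski topology of the plane *)

Section Polynomials.
Variable k : numFieldType.

(** The integers are distinct in k, and [size q] of them are too many to be all roots of q. *)
Lemma poly_nonroot (q : {poly k}) : q != 0 -> exists x, q.[x] != 0.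
Proof.
move=> q0; apply: contrapT => /forallNP h.
have /allP : all (root q) [seq (i%:R : k) | i <- iota 0 (size q)].
  by apply/allP => x _; rewrite rootE; apply: contrapT => /negP; exact: h.
move/allP => rq; have := max_poly_roots q0 rq.
rewrite size_map size_iota ltnn => /(_ _)/negP; apply=> //.
by rewrite map_inj_uniq ?iota_uniq// => i j /eqP; rewrite Num.Theory.eqr_nat => /eqP.
Qed.

Lemma poly_eq0_off (q p : {poly k}) : q != 0 ->
  (forall x, q.[x] != 0 -> p.[x] = 0) -> p = 0.
Proof.
move=> q0 h; apply/eqP; apply: contraT => p0.
have [x] := poly_nonroot (mulf_neq0 q0 p0).
by rewrite hornerM mulf_eq0 negb_or => /andP[/h -> ]; rewrite eqxx.
Qed.

Lemma poly_neq0 (q : {poly k}) x : q.[x] != 0 -> q != 0.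
Proof. by apply: contraNneq => ->; rewrite horner0. Qed.

Definition lin_poly (a b : k) : {poly k} := a%:P * 'X + b%:P.

Lemma horner_comp_lin (r : {poly k}) a b x :
  (r \Po lin_poly a b).[x] = r.[a * x + b].
Proof. by rewrite horner_comp hornerD hornerM !hornerC hornerX. Qed.

Lemma comp_lin_neq0 (r : {poly k}) a b : a != 0 -> r != 0 ->
  r \Po lin_poly a b != 0.
Proof.
move=> a0 /poly_nonroot[z rz]; apply: (@poly_neq0 _ ((z - b) / a)).
by rewrite horner_comp_lin mulrCA divff // mulr1 subrK.
Qed.

Lemma peval_curve n (p : {mpoly k[n]}) (a : 'I_n -> {poly k}) :
  exists P : {poly k}, forall x, P.[x] = peval p (\row_i (a i).[x]).
Proof.
exists (mmap (polyC : k -> {poly k}) a p) => x.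
rewrite /peval /meval /mmap horner_sum; apply: eq_bigr => m _.
rewrite hornerM hornerC; congr (_ * _).
rewrite /mmap1 horner_prod; apply: eq_bigr => i _.
by rewrite horner_exp mxE.
Qed.

(** Brings genericity down to one variable: a polynomial that does not vanish at one point of a
    parametrised curve restricts to a nonzero polynomial in the parameter. *)
Lemma affine_open_curve n (U : set (affine k n)) (a : 'I_n -> {poly k}) x :
  zopen U -> U (\row_i (a i).[x]) ->
  exists q : {poly k}, q.[x] != 0 /\
    forall y, q.[y] != 0 -> U (\row_i (a i).[y]).
Proof.
move=> /affine_openP oU /oU [p [px pU]].
have [P PE] := peval_curve p a; exists P; rewrite PE; split=> // y.
by rewrite PE; exact: pU.
Qed.

(** On the line that joins a point of U (parameter 0) to a point of V (parameter 1), each of the two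
    sets contains all but finitely many points. *)
Lemma affine_open_meet n (U V : set (affine k n)) :
  zopen U -> zopen V -> U !=set0 -> V !=set0 -> (U `&` V) !=set0.
Proof.
move=> oU oV [u Uu] [v Vv].
pose a i : {poly k} := (u ord0 i)%:P + (v ord0 i - u ord0 i)%:P * 'X.
have a0 : \row_i (a i).[0] = u.
  by apply/rowP => i; rewrite mxE !hornerE ?mulr0 ?addr0.
have a1 : \row_i (a i).[1] = v.
  by apply/rowP => i; rewrite mxE /a hornerD hornerM !hornerC hornerX mulr1 addrC subrK.
have [|p [p0 pU]] := @affine_open_curve _ U a 0 oU; first by rewrite a0.
have [|q [q0 qV]] := @affine_open_curve _ V a 1 oV; first by rewrite a1.
have [x] := poly_nonroot (mulf_neq0 (poly_neq0 p0) (poly_neq0 q0)).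
rewrite hornerM mulf_eq0 negb_or => /andP[/pU ? /qV ?].
by exists (\row_i (a i).[x]).
Qed.

Lemma proj_open_dense n (U : set (proj k n)) :
  zopen U -> U !=set0 -> zdense U.
Proof.
move=> oU [L UL] O oO [L' OL'].
have [v v0 vL] := hpt_surj L; have [v' v0' vL'] := hpt_surj L'.
have [||w [[w0 Ow] [_ Uw]]] := affine_open_meet oO oU.
- by exists v'; split; rewrite ?vL'.
- by exists v; split; rewrite ?vL.
- by exists (hpt w).
Qed.

Lemma affine_neq0 (c d : k) : (c != 0) || (d != 0) -> exists x, c * x + d != 0.
Proof.
have [->|d0 _] := eqVneq d 0; last by exists 0; rewrite mulr0 add0r.
by rewrite orbF => c0; exists 1; rewrite mulr1 addr0.
Qed.

End Polynomials.

(** * Affine coordinates on the projective plane *)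

Section Plane.
Variable k : numFieldType.
Local Notation P2 := (proj k 2).

Definition hrow (x y z : k) : 'rV[k]_3 := \row_(i < 3) [:: x; y; z]`_i.

Lemma ratio3E x y z : @ratio3 k x y z = hpt (hrow x y z).
Proof. by []. Qed.

Lemma hrowP (v : 'rV[k]_3) : v = hrow (v ord0 0) (v ord0 1) (v ord0 2%:R).
Proof.
apply/rowP => i; rewrite mxE; case: i => -[|[|[|//]]] hi /=;
  congr (v _ _); exact: val_inj.
Qed.

Lemma hrow1_neq0 x y : hrow x y 1 != 0.
Proof.
by apply/eqP => /rowP /(_ 2%:R); rewrite !mxE /= => /eqP; rewrite oner_eq0.
Qed.

Lemma hptZ n (c : k) (v : 'rV[k]_n.+1) : c != 0 -> hpt (c *: v) = hpt v.
Proof.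
move=> c0; apply: val_inj; rewrite !val_insubd.
have -> // : <[c *: v]>%VS = <[v]>%VS.
apply: subv_anti; rewrite -!memvE memvZ ?memv_line //=.
by rewrite -[X in X \in _](scalerK c0) memvZ// memv_line.
Qed.

(* The affine coordinates cx and cy are irrelevant outside [chart]. *)
Definition hcoord (L : P2) : 'rV[k]_3 := vpick (val L).
Definition cx (L : P2) := hcoord L ord0 0 / hcoord L ord0 2%:R.
Definition cy (L : P2) := hcoord L ord0 1 / hcoord L ord0 2%:R.
Definition chart : set P2 := [set L | hcoord L ord0 2%:R != 0].

Lemma hcoordP v : v != 0 -> exists2 c, c != 0 & hcoord (hpt v) = c *: v.
Proof.
move=> v0; have vE : val (hpt v : P2) = <[v]>%VS.
  by rewrite val_insubd dim_vline v0.
have : hcoord (hpt v) \in <[v]>%VS by rewrite /hcoord vE memv_pick.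
move=> /vlineP[c cE]; exists c => //; apply: contra_eq_neq cE => ->.
by rewrite scale0r /hcoord vE vpick0 -dimv_eq0 dim_vline v0.
Qed.

Lemma chart_hpt v : v != 0 -> chart (hpt v) <-> v ord0 2%:R != 0.
Proof.
move=> v0; have [c c0 cE] := hcoordP v0.
by rewrite /chart /= cE mxE mulf_eq0 (negbTE c0).
Qed.

Lemma cx_hpt v : v != 0 -> cx (hpt v) = v ord0 0 / v ord0 2%:R.
Proof.
move=> v0; have [c c0 cE] := hcoordP v0.
by rewrite /cx cE !mxE -mulf_div divff// mul1r.
Qed.

Lemma cy_hpt v : v != 0 -> cy (hpt v) = v ord0 1 / v ord0 2%:R.
Proof.
move=> v0; have [c c0 cE] := hcoordP v0.
by rewrite /cy cE !mxE -mulf_div divff// mul1r.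
Qed.

Lemma chart_ratio3 x y : chart (@ratio3 k x y 1).
Proof. by apply/(chart_hpt (hrow1_neq0 x y)); rewrite mxE oner_neq0. Qed.

Lemma cx_ratio3 x y : cx (@ratio3 k x y 1) = x.
Proof. by rewrite (cx_hpt (hrow1_neq0 x y)) !mxE /= divr1. Qed.

Lemma cy_ratio3 x y : cy (@ratio3 k x y 1) = y.
Proof. by rewrite (cy_hpt (hrow1_neq0 x y)) !mxE /= divr1. Qed.

Lemma ratio3_inj x y x' y' : @ratio3 k x y 1 = @ratio3 k x' y' 1 -> x = x' /\ y = y'.
Proof.
move=> e; split.
  by rewrite -[LHS](cx_ratio3 x y) e cx_ratio3.
by rewrite -[LHS](cy_ratio3 x y) e cy_ratio3.
Qed.

Lemma chartP (L : P2) : chart L -> L = @ratio3 k (cx L) (cy L) 1.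
Proof.
have [v v0 <-] := hpt_surj L => /(chart_hpt v0) v2.
rewrite cx_hpt // cy_hpt // ratio3E -[RHS](hptZ _ v2); congr hpt.
apply/rowP => i; rewrite [in LHS](hrowP v) !mxE.
by case: i => -[|[|[|//]]] hi /=; rewrite ?mulr1 // mulrC divfK.
Qed.

Lemma zopen_chart : @zopen k P2 chart.
Proof.
have e : @cone k 2 chart = [set v : affine k 3 | v != 0] `&`
    [set v | v ord0 2%:R != 0].
  by apply/seteqP; split=> v [v0 /(chart_hpt v0)]; split.
suff : @zopen k (affine k 3) (@cone k 2 chart) by [].
rewrite e; apply: zopenI; first exact: zopen_neq0.
apply/affine_openP => v v2; exists 'X_(2%:R : 'I_3); rewrite /peval mevalXU.
by split=> // w; rewrite mevalXU.
Qed.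

Lemma zdense_chart : @zdense k P2 chart.
Proof.
apply: proj_open_dense; first exact: zopen_chart.
by exists (@ratio3 k 0 0 1); exact: chart_ratio3.
Qed.

Lemma regular_coord n i (v : affine k n) :
  @regular k (affine k n) (fun w => w ord0 i) v.
Proof.
exists 'X_i, 1, setT; split=> //; first exact: affine_openT.
by move=> w _; rewrite /peval meval1 mevalXU oner_neq0 divr1.
Qed.

Lemma regular_cxy (i : 'I_3) (f : P2 -> k) L : chart L ->
  (forall v, v != 0 -> f (hpt v) = v ord0 i / v ord0 2%:R) -> @regular k P2 f L.
Proof.
move=> cL fE v v0 vL; move: cL; rewrite -vL => /(chart_hpt v0) v2.
apply: (@regular_local k (affine k 3) _ (fun w => w ord0 i / w ord0 2%:R) _ v
  (@zopen_neq0 k 2) v0) => [w w0 /=|]; first by rewrite fE.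
apply: regular_div => //; [exact: local_units_affine| |]; exact: regular_coord.
Qed.

Lemma regular_cx L : chart L -> @regular k P2 cx L.
Proof. by move=> cL; apply: regular_cxy cL _ => v; exact: cx_hpt. Qed.

Lemma regular_cy L : chart L -> @regular k P2 cy L.
Proof. by move=> cL; apply: regular_cxy cL _ => v; exact: cy_hpt. Qed.

Lemma morphism_at_ratio3 (X : kspace k) (f g : X -> k) x : local_units X ->
  regular f x -> regular g x ->
  @morphism_at k X P2 (fun y => @ratio3 k (f y) (g y) 1) x.
Proof.
move=> lX rf rg.
apply: (@morphism_at_comp k X (affine k 3) P2 (@hpt k 2)
  (fun y => hrow (f y) (g y) 1)); last exact/morphism_at_hpt/hrow1_neq0.
apply: morphism_at_affine => // i.
case: i => -[|[|[|//]]] hi.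
- by apply: (regular_local (zopenT X) _ _ rf) => // y _; rewrite mxE.
- by apply: (regular_local (zopenT X) _ _ rg) => // y _; rewrite mxE.
- apply: (regular_local (zopenT X) (f := fun=> 1)) => //; last exact: regularC.
  by move=> y _; rewrite mxE.
Qed.

Lemma local_units_P2 : local_units P2.
Proof. exact: local_units_proj. Qed.

Lemma plane_open_point (W : set P2) : zopen W -> W !=set0 ->
  exists x y, W (@ratio3 k x y 1).
Proof.
move=> oW W0; have [L [WL cL]] := zdense_chart oW W0.
by exists (cx L), (cy L); rewrite -chartP.
Qed.

Lemma plane_open_line (W : set P2) (a b : {poly k}) s : zopen W ->
  W (@ratio3 k a.[s] b.[s] 1) ->
  exists q : {poly k}, q.[s] != 0 /\
    forall t, q.[t] != 0 -> W (@ratio3 k a.[t] b.[t] 1).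
Proof.
move=> oW Ws.
have e t : \row_i ([:: a; b; 1]`_i : {poly k}).[t] = hrow a.[t] b.[t] 1.
  apply/rowP => i; rewrite !mxE; case: i => -[|[|[|//]]] hi //=.
  by rewrite hornerC.
have [|q [qs qW]] := @affine_open_curve k 3 (cone W)
    (fun i => [:: a; b; 1]`_i) s oW.
  by rewrite e; split=> //; exact: hrow1_neq0.
by exists q; split=> // t /qW; rewrite e => -[].
Qed.

Lemma plane_open_vline (W : set P2) x y : zopen W -> W (@ratio3 k x y 1) ->
  exists q : {poly k}, q.[y] != 0 /\ forall z, q.[z] != 0 -> W (@ratio3 k x z 1).
Proof.
move=> oW Wxy; have [|q [qy qW]] := @plane_open_line W x%:P 'X y oW.
  by rewrite hornerC hornerX.
by exists q; split=> // z /qW; rewrite hornerC hornerX.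
Qed.

Lemma plane_open_hline (W : set P2) x y : zopen W -> W (@ratio3 k x y 1) ->
  exists q : {poly k}, q.[x] != 0 /\ forall z, q.[z] != 0 -> W (@ratio3 k z y 1).
Proof.
move=> oW Wxy; have [|q [qy qW]] := @plane_open_line W 'X y%:P x oW.
  by rewrite hornerC hornerX.
by exists q; split=> // z /qW; rewrite hornerC hornerX.
Qed.

Lemma plane_dense_cy (W : set P2) (p : {poly k}) : zopen W -> zdense W ->
  (forall x y, W (@ratio3 k x y 1) -> p.[y] = 0) -> p = 0.
Proof.
move=> oW dW h.
have [|L [_ WL]] := dW setT (zopenT _).
  by exists (@ratio3 k 0 0 1).
have [|x [y Wxy]] := plane_open_point oW; first by exists L.
have [q [qy qW]] := plane_open_vline oW Wxy.
by apply: (@poly_eq0_off k q) => [|z /qW /h //]; exact: poly_neq0 qy.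
Qed.

Lemma zopen_chart_regular (D : set P2) (f : P2 -> k) : zopen D ->
  (forall L, D L -> regular f L) -> zopen (D `&` [set L | f L != 0]).
Proof. by move=> oD rf; apply: zopen_regular_neq0 => //; exact: local_units_P2. Qed.

(** The shape of most generic conditions below: for a = 0 it removes the fibres over the roots of b,
    and in general it removes the poles of a homography in x with denominator a x + b. *)
Definition affine_locus (a b : {poly k}) : set P2 :=
  chart `&` [set L | a.[cy L] * cx L + b.[cy L] != 0].

Lemma affine_locus_open a b : zopen (affine_locus a b).
Proof.
apply: zopen_chart_regular => [|L cL]; first exact: zopen_chart.
apply: regularD; last by apply: regular_horner; exact: regular_cy.
apply: regularM; last exact: regular_cx.
by apply: regular_horner; exact: regular_cy.
Qed.

Lemma affine_locus_dense a b : (a != 0) || (b != 0) -> zdense (affine_locus a b).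
Proof.
move=> ab; apply: proj_open_dense; first exact: affine_locus_open.
have [y hy] : exists y, (a.[y] != 0) || (b.[y] != 0).
  by case/orP: ab => /poly_nonroot[y hy]; exists y; rewrite hy ?orbT.
have [x hx] := affine_neq0 hy.
exists (@ratio3 k x y 1); split; first exact: chart_ratio3.
by rewrite /= cx_ratio3 cy_ratio3.
Qed.

Lemma affine_locusP a b x y :
  affine_locus a b (@ratio3 k x y 1) <-> a.[y] * x + b.[y] != 0.
Proof.
rewrite /affine_locus /= cx_ratio3 cy_ratio3; split=> [[]//|h]; split=> //.
exact: chart_ratio3.
Qed.

End Plane.

(** * Birational transformations in affine coordinates *)

Section Forms.
Variable k : numFieldType.
Local Notation P2 := (proj k 2).

(** A product is the class of the composite of the chosen representatives, whereas [sends] refers to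
    the representative chosen for the product; the two are only known to agree on a dense open
    set. *)
Lemma sends_mul (X : kspace k) (f g : bir X) : exists W : set X,
  [/\ zopen W, zdense W & forall x y z, W x -> sends g x y -> sends f y z ->
    sends (f * g)%g x z].
Proof.
have /bireq_sym[W [oW dW h]] := repr_bireq (Defs.pcomp (repr f) (repr g)).
exists W; split=> // x y z /h[_ fgx e] [gx gy] [fy fz]; split=> //.
by rewrite [LHS]/= -e /= gy.
Qed.

Lemma affine_form_eq (f f' : bir P2) u u' (W : set P2) :
  affine_form f u -> affine_form f' u' -> zopen W -> zdense W ->
  (forall x y, W (ratio3 x y 1) -> u x y = u' x y) -> f = f'.
Proof.
move=> [W1 [oW1 dW1 h1]] [W2 [oW2 dW2 h2]] oW dW uu'.
rewrite -[f]reprK -[f']reprK; apply/bir_eqP.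
have oc := @zopen_chart k; have dc := @zdense_chart k.
exists (@chart k `&` (W `&` (W1 `&` W2))); split.
- by apply: zopenI => //; apply: zopenI => //; exact: zopenI.
- by apply: zdenseI => //; apply: zdenseI => //; exact: zdenseI.
- move=> L [/chartP ->] [WL [/h1[f1 e1] /h2[f2 e2]]].
  by split=> //; rewrite e1 e2 uu'.
Qed.

Lemma affine_form_unique (f : bir P2) u u' :
  affine_form f u -> affine_form f u' -> exists W : set P2,
    [/\ zopen W, zdense W & forall x y, W (ratio3 x y 1) -> u x y = u' x y].
Proof.
move=> [W1 [oW1 dW1 h1]] [W2 [oW2 dW2 h2]].
exists (W1 `&` W2); split; [exact: zopenI|exact: zdenseI|].
move=> x y [/h1[_ e1] /h2[_ e2]]; move: e1; rewrite e2 => /ratio3_inj[].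
by case: (u x y) (u' x y) => [? ?] [? ?] /= -> ->.
Qed.

Lemma affine_form_comp (f g : bir P2) u v : affine_form f u -> affine_form g v ->
  affine_form (f * g)%g (fun x y => u (v x y).1 (v x y).2).
Proof.
move=> [W1 [oW1 dW1 h1]] [W2 [oW2 dW2 h2]].
have [W [oW dW h]] := sends_mul f g.
exists (W `&` (W2 `&` (pdom (repr g) `&` pfun (repr g) @^-1` W1))).
have oD : zopen (pdom (repr g) `&` pfun (repr g) @^-1` W1).
  by apply: preimage_open => //; [exact: pdom_open|exact: pfun_morphism].
split.
- by apply: zopenI => //; exact: zopenI.
- by apply: zdenseI => //; apply: zdenseI => //; exact: pdom_comp_dense.
- move=> x y [Wx [W2x [gx W1x]]]; have [gx' e2] := h2 _ _ W2x.
  apply: (h _ _ _ Wx (h2 _ _ W2x)); apply: h1; rewrite -e2; exact: W1x.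
Qed.

(** This makes [pr2] well defined: the difference of the two affine functions of y vanishes on a
    dense open set, hence as a polynomial. *)
Lemma affine_form_snd_unique (f : bir P2) u u' a b a' b' :
  affine_form f u -> affine_form f u' ->
  (forall x y, (u x y).2 = a * y + b) -> (forall x y, (u' x y).2 = a' * y + b') ->
  a = a' /\ b = b'.
Proof.
move=> fu fu' ue ue'; have [W [oW dW h]] := affine_form_unique fu fu'.
pose p : {poly k} := (a - a')%:P * 'X + (b - b')%:P.
have p0 : p = 0.
  apply: (plane_dense_cy oW dW) => x y /h e.
  rewrite /p hornerD hornerM !hornerC hornerX.
  have := congr1 snd e; rewrite ue ue' => /eqP; rewrite -subr_eq0 => /eqP <-.
  by rewrite mulrBl opprD addrACA.
have := congr1 (fun q : {poly k} => q`_1) p0.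
have := congr1 (fun q : {poly k} => q`_0) p0.
rewrite !coefD !coefMX !coefC /= add0r addr0.
by move=> /eqP; rewrite subr_eq0 => /eqP -> /eqP; rewrite subr_eq0 => /eqP ->.
Qed.

(** * Construction of the transformations of PGL_2(C(y)) x| Aff_1 with polynomial coefficients *)

Section Jonquieres.
Variables (m00 m01 m10 m11 : {poly k}) (a b : k).
Hypothesis det_neq0 : m00 * m11 - m01 * m10 != 0.
Hypothesis a_neq0 : a != 0.

Let det := m00 * m11 - m01 * m10.
(** [fac] is the denominator of the homography, [fbc] that of the inverse homography given by the
    adjugate matrix, and [lin] is the inverse of y |-> a y + b. *)
Let fac (x y : k) := m10.[y] * x + m11.[y].
Let fbc (x y : k) := m00.[y] - m10.[y] * x.
Let lin (y : k) := (y - b) / a.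

Definition jonq_dom : set P2 :=
  (@chart k `&` [set L | det.[cy L] != 0]) `&` [set L | fac (cx L) (cy L) != 0].
Definition jonq_cod : set P2 := (@chart k `&` [set L | det.[lin (cy L)] != 0])
  `&` [set L | fbc (cx L) (lin (cy L)) != 0].
Definition jonq_fun (L : P2) : P2 := @ratio3 k
  ((m00.[cy L] * cx L + m01.[cy L]) / fac (cx L) (cy L)) (a * cy L + b) 1.
Definition jonq_inv (L : P2) : P2 := let y := lin (cy L) in @ratio3 k
  ((m11.[y] * cx L - m01.[y]) / fbc (cx L) y) y 1.

Let reg_lin L : chart L -> @regular k P2 (fun L => lin (cy L)) L.
Proof.
move=> cL; apply: regularM; last exact: regularC.
by apply: regularB; [exact: regular_cy|exact: regularC].
Qed.

Let reg_fac L : chart L -> @regular k P2 (fun L => fac (cx L) (cy L)) L.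
Proof.
move=> cL; apply: regularD; last by apply: regular_horner; exact: regular_cy.
apply: regularM; last exact: regular_cx.
by apply: regular_horner; exact: regular_cy.
Qed.

Let reg_fbc L : chart L -> @regular k P2 (fun L => fbc (cx L) (lin (cy L))) L.
Proof.
move=> cL; apply: regularB; first by apply: regular_horner; exact: reg_lin.
apply: regularM; last exact: regular_cx.
by apply: regular_horner; exact: reg_lin.
Qed.

Fact jonq_dom_open : zopen jonq_dom.
Proof.
apply: zopen_chart_regular => [|L [cL _]]; last exact: reg_fac.
apply: zopen_chart_regular => [|L cL]; first exact: zopen_chart.
by apply: regular_horner; exact: regular_cy.
Qed.

Fact jonq_cod_open : zopen jonq_cod.
Proof.
apply: zopen_chart_regular => [|L [cL _]]; last exact: reg_fbc.
apply: zopen_chart_regular => [|L cL]; first exact: zopen_chart.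
by apply: regular_horner; exact: reg_lin.
Qed.

Let lin_aff y : lin (a * y + b) = y.
Proof. by rewrite /lin addrK mulrC mulKf. Qed.

Let aff_lin y : a * lin y + b = y.
Proof. by rewrite /lin mulrCA divff// mulr1 subrK. Qed.

Let detE y : det.[y] = m00.[y] * m11.[y] - m01.[y] * m10.[y].
Proof. by rewrite /det hornerD hornerN !hornerM. Qed.

Fact jonq_dom_dense : zdense jonq_dom.
Proof.
apply: proj_open_dense; first exact: jonq_dom_open.
have [y dy] := poly_nonroot det_neq0.
have [|x fx] := @affine_neq0 k m10.[y] m11.[y].
  rewrite -negb_and; apply: contra dy => /andP[/eqP c0 /eqP d0].
  by rewrite detE c0 d0 !mulr0 subrr.
exists (@ratio3 k x y 1); split=> /=; last by rewrite /= cx_ratio3 cy_ratio3.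
by split; [exact: chart_ratio3|rewrite /= cy_ratio3].
Qed.

Fact jonq_cod_dense : zdense jonq_cod.
Proof.
apply: proj_open_dense; first exact: jonq_cod_open.
have [y dy] := poly_nonroot det_neq0.
have [|x fx] := @affine_neq0 k (- m10.[y]) m00.[y].
  rewrite -negb_and; apply: contra dy => /andP[/eqP c0 /eqP d0].
  by move/eqP: c0; rewrite oppr_eq0 => /eqP c0; rewrite detE c0 d0 mulr0 mul0r subrr.
exists (@ratio3 k x (a * y + b) 1).
split; last by rewrite /= cx_ratio3 cy_ratio3 lin_aff /fbc addrC -mulNr.
by split; [exact: chart_ratio3|rewrite /= cy_ratio3 lin_aff].
Qed.

Fact jonq_fun_morphism : morphism_on jonq_dom jonq_fun.
Proof.
move=> L [[cL _] fL]; apply: morphism_at_ratio3; first exact: local_units_P2.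
  apply: regular_div => //; [exact: local_units_P2| |exact: reg_fac].
  apply: regularD; last by apply: regular_horner; exact: regular_cy.
  apply: regularM; last exact: regular_cx.
  by apply: regular_horner; exact: regular_cy.
apply: regularD; last exact: regularC.
by apply: regularM; [exact: regularC|exact: regular_cy].
Qed.

Fact jonq_inv_morphism : morphism_on jonq_cod jonq_inv.
Proof.
move=> L [[cL _] fL]; apply: morphism_at_ratio3; first exact: local_units_P2.
  apply: regular_div => //; [exact: local_units_P2| |exact: reg_fbc].
  apply: regularB; last by apply: regular_horner; exact: reg_lin.
  apply: regularM; last exact: regular_cx.
  by apply: regular_horner; exact: reg_lin.
exact: reg_lin.
Qed.

Fact jonq_funP L : jonq_dom L -> jonq_cod (jonq_fun L) /\ jonq_inv (jonq_fun L) = L.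
Proof.
move=> [[cL /= dL] fL].
(* At the image point the denominator of the inverse equals det / fac, which is nonzero because the
   fibres where det vanishes have been removed. *)
have e : fbc ((m00.[cy L] * cx L + m01.[cy L]) / fac (cx L) (cy L)) (cy L) =
    det.[cy L] / fac (cx L) (cy L).
  by rewrite detE /fbc; move: fL; rewrite /fac => fL; field.
split.
  split; first split; [exact: chart_ratio3|by rewrite /= cy_ratio3 lin_aff|].
  by rewrite /= cx_ratio3 cy_ratio3 lin_aff e mulf_neq0 ?invr_eq0.
rewrite [RHS](chartP cL) /jonq_inv cx_ratio3 cy_ratio3 lin_aff e.
congr ratio3; move: fL dL; rewrite detE /= /fac => fL dL; field.
by rewrite fL.
Qed.

Fact jonq_invP L : jonq_cod L -> jonq_dom (jonq_inv L) /\ jonq_fun (jonq_inv L) = L.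
Proof.
move=> [[cL /= dL] fL]; set y := lin (cy L) in dL fL.
have e : fac ((m11.[y] * cx L - m01.[y]) / fbc (cx L) y) y =
    det.[y] / fbc (cx L) y.
  by rewrite detE /fac; move: fL; rewrite /fbc => fL; field.
split.
  split; first split; [exact: chart_ratio3|by rewrite /= cy_ratio3|].
  by rewrite /= cx_ratio3 cy_ratio3 e mulf_neq0 ?invr_eq0.
rewrite [RHS](chartP cL) /jonq_fun cx_ratio3 cy_ratio3 aff_lin e.
congr ratio3; move: fL dL; rewrite detE /= /fbc -/y => fL dL; field.
by rewrite fL.
Qed.

Definition jonq_iso : partial_iso P2 := PartialIso jonq_dom_open jonq_cod_open
  jonq_dom_dense jonq_cod_dense jonq_fun_morphism jonq_inv_morphism
  jonq_funP jonq_invP.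

Lemma jonq_exists : exists f : bir P2, affine_form f (fun x y =>
  ((m00.[y] * x + m01.[y]) / (m10.[y] * x + m11.[y]), a * y + b)).
Proof.
exists (\pi_(bir P2) jonq_iso).
have [W [oW dW h]] := repr_bireq jonq_iso.
exists W; split=> // x y /h[fx _ e]; split=> //.
by rewrite e /= /jonq_fun cx_ratio3 cy_ratio3.
Qed.

End Jonquieres.

End Forms.

Lemma frac_numden (R : idomainType) (r : {fraction R}) :
  r * tofrac (\d_(repr r)) = tofrac (\n_(repr r)).
Proof.
rewrite -{1}[r]reprK; move: (repr r) => x.
unlock FracField.tofrac; rewrite -[LHS]FracField.pi_mul.
apply/eqmodP; rewrite /= FracField.equivfE /FracField.mulf /=.
by rewrite !numden_Ratio ?oner_eq0 ?mulr1 ?denom_ratioP // mulrC.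
Qed.

Lemma det_mx2 (R : comNzRingType) (M : 'M[R]_2) :
  \det M = M 0 0 * M 1 1 - M 0 1 * M 1 0.
Proof.
rewrite (expand_det_row _ 0) big_ord_recl big_ord1 /cofactor !det_mx11 !mxE /=.
rewrite expr0 expr1 mul1r mulN1r mulrN.
by congr (_ * M _ _ - M _ _ * M _ _); apply: val_inj.
Qed.

Lemma ord2P (i : 'I_2) : i = 0 \/ i = 1.
Proof. by case: i => -[|[|//]] hi; [left|right]; exact: val_inj. Qed.

(** * Evaluation of rational functions of y *)

Section RatEval.
Variable k : numFieldType.
Local Notation F := {fraction {poly k}}.

Definition den (r : F) : {poly k} := \d_(repr r).

Lemma den_neq0 r : den r != 0. Proof. exact: denom_ratioP. Qed.

Lemma rat_evalE (r : F) y : rat_eval r y = (\n_(repr r)).[y] / (den r).[y].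
Proof. by []. Qed.

Lemma rat_eval_tofrac (p : {poly k}) y : (den (tofrac p)).[y] != 0 ->
  rat_eval (tofrac p) y = p.[y].
Proof.
move=> dy; rewrite rat_evalE; have /eqP := frac_numden (tofrac p).
rewrite -tofracM tofrac_eq => /eqP <-.
by rewrite hornerM mulfK.
Qed.

Lemma regular_rat_eval (X : kspace k) (r : F) (f : X -> k) x : local_units X ->
  regular f x -> (den r).[f x] != 0 ->
  @regular k X (fun y => rat_eval r (f y)) x.
Proof.
move=> lX rf dx; apply: regular_div => //; exact: regular_horner.
Qed.

Lemma rat_mx_generic (M : 'M[F]_2) : M \in unitmx -> exists q : {poly k},
  q != 0 /\ forall y, q.[y] != 0 -> (forall i j, (den (M i j)).[y] != 0) /\
    rat_eval (M 0 0) y * rat_eval (M 1 1) y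
      - rat_eval (M 0 1) y * rat_eval (M 1 0) y != 0.
Proof.
rewrite unitmxE unitfE det_mx2 => dM.
pose n i j : {poly k} := \n_(repr (M i j)).
pose d i j := den (M i j).
(* D is the product of the four denominators and N is the determinant of M times D, so that D N != 0
   at y gives both conclusions. *)
pose D := d 0 0 * d 1 1 * (d 0 1 * d 1 0).
pose N := n 0 0 * n 1 1 * (d 0 1 * d 1 0) - n 0 1 * n 1 0 * (d 0 0 * d 1 1).
have d0 i j : d i j != 0 by exact: den_neq0.
exists (D * N); split.
  have D0 : D != 0 by rewrite !mulf_neq0.
  rewrite mulf_neq0 // -tofrac_eq0.
  have -> : tofrac N = (M 0 0 * M 1 1 - M 0 1 * M 1 0) * tofrac D.
    rewrite /N /D tofracB !tofracM -!frac_numden -!/(d _ _); ring.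
  by apply: mulf_neq0; [exact: dM|rewrite tofrac_eq0].
move=> y; rewrite hornerM mulf_eq0 negb_or => /andP[Dy Ny].
have dij i j : (d i j).[y] != 0.
  move: Dy; rewrite /D !hornerM !mulf_eq0 !negb_or => /andP[/andP[? ?] /andP[? ?]].
  by case: (ord2P i) => ->; case: (ord2P j) => ->.
split=> //; apply: contra Ny => /eqP e.
rewrite /N hornerD hornerN !hornerM.
rewrite !rat_evalE -!/(n _ _) -!/(d _ _) in e.
have := congr1 (fun z => z * ((d 0 0).[y] * (d 1 1).[y] * (d 0 1).[y] * (d 1 0).[y])) e.
rewrite mul0r => <-; apply/eqP; field.
by rewrite !dij.
Qed.

End RatEval.

(** * The multiplicative group and its characters *)

Section MultiplicativeGroup.
Variable k : numFieldType.
Local Notation Gm := (Gm k).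
Local Notation Gms := (space_of Gm).

Lemma local_units_Gm : local_units Gms.
Proof. exact/local_units_induced/local_units_affine. Qed.

Lemma affine1_open_Gm (O : set (affine k 1)) (t : Gm) : zopen O ->
  O (\row_(i < 1) val t) -> exists q : {poly k}, q.[val t] != 0 /\
    forall x, q.[x] != 0 -> O (\row_(i < 1) x).
Proof.
move=> oO; have e x : \row_(i < 1) x = \row_(i < 1) ('X : {poly k}).[x].
  by apply/rowP => i; rewrite !mxE hornerX.
rewrite e => /(affine_open_curve oO)[q [qt qO]]; exists q; split=> // x.
by rewrite e; exact: qO.
Qed.

Lemma Gm_open_poly (O : set Gms) (t : Gm) : zopen O -> O t ->
  exists q : {poly k}, q.[val t] != 0 /\ forall s : Gm, q.[val s] != 0 -> O s.
Proof.
move=> [O' oO' ->] O't; have [q [qt qO]] := affine1_open_Gm oO' O't.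
by exists q; split=> // s; exact: qO.
Qed.

Lemma Gm_regular_poly (f : Gms -> k) (t : Gm) : regular f t ->
  exists p q : {poly k}, q.[val t] != 0 /\
    forall s : Gm, q.[val s] != 0 -> f s = p.[val s] / q.[val s].
Proof.
move=> [O [g [oO Ot [p [q [U [oU Ut h]]]] fg]]].
have e x : \row_(i < 1) x = \row_(i < 1) ('X : {poly k}).[x].
  by apply/rowP => i; rewrite !mxE hornerX.
have [P PE] := peval_curve p (fun=> 'X); have [Q QE] := peval_curve q (fun=> 'X).
have [r [rt rOU]] := affine1_open_Gm (zopenI oO oU) (conj Ot Ut).
(* The common factor r records the neighbourhood on which f = P / Q: off the zeros of the new
   denominator the formula is valid. *)
exists (P * r), (Q * r); split.
  by rewrite hornerM mulf_neq0 // QE -e; have [] := h _ Ut.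
move=> s; rewrite hornerM mulf_eq0 negb_or => /andP[Qs rs].
have [Os Us] := rOU _ rs; rewrite fg //; have [_ ->] := h _ Us.
by rewrite hornerM -mulf_div divff// mulr1 PE QE -e.
Qed.

Lemma regular_Gm_val (t : Gm) : @regular k Gms (fun s => val s) t.
Proof.
exists setT, (fun v : affine k 1 => v ord0 ord0); split=> //.
- exact: zopenT.
- exact: regular_coord.
- by move=> s _; rewrite mxE.
Qed.

Lemma morphism_at_Gm (X : kspace k) (f : X -> Gms) x : local_units X ->
  @regular k X (fun y => val (f y)) x -> morphism_at f x.
Proof.
move=> lX rf; apply: morphism_at_induced; apply: morphism_at_affine => // i.
by apply: (regular_local (zopenT X) _ _ rf) => // y _; rewrite /= mxE.
Qed.

Definition gm (t : k) (t0 : t != 0) : Gm := exist (fun x : k => x != 0) t t0.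

Lemma gm_surj (t : k) : t != 0 -> exists s : Gm, val s = t.
Proof. by move=> t0; exists (gm t0). Qed.

Lemma Gm_valM (s t : Gm) : val (s * t)%g = val s * val t. Proof. by []. Qed.
Lemma Gm_valV (s : Gm) : val (s^-1)%g = (val s)^-1. Proof. by []. Qed.

Lemma Gm_nonroot (q : {poly k}) : q != 0 -> exists s : Gm, q.[val s] != 0.
Proof.
move=> q0; have [x] := poly_nonroot (mulf_neq0 q0 (negbT (polyX_eq0 k))).
rewrite hornerM hornerX mulf_eq0 negb_or => /andP[qx x0].
by exists (gm x0).
Qed.

Lemma irreducible_Gm : irreducible Gms.
Proof.
split=> [|F1 F2 c1 c2 F12]; first by exists (1%g : Gm).
apply: contrapT => /not_orP[n1 n2].
have ne (F : set Gms) : F <> setT -> exists t, (~` F) t.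
  by move=> nF; apply: contrapT => /forallNP h; apply: nF; apply/seteqP; split=> // t _;
    apply: contrapT => /h.
have [t1 h1] := ne _ n1; have [t2 h2] := ne _ n2.
have [q1 [q1t q1F]] := Gm_open_poly c1 h1.
have [q2 [q2t q2F]] := Gm_open_poly c2 h2.
have [s] := Gm_nonroot (mulf_neq0 (poly_neq0 q1t) (poly_neq0 q2t)).
rewrite hornerM mulf_eq0 negb_or => /andP[/q1F s1 /q2F s2].
have : (F1 `|` F2) s by rewrite F12.
by case.
Qed.

Lemma poly_X_factor (p : {poly k}) : p != 0 ->
  exists q n, q.[0] != 0 /\ p = q * 'X^n.
Proof.
move=> p0; have [n [q]] := multiplicity_XsubC p 0.
rewrite p0 subr0 /= => q0 ->; exists q, n; split=> //.
Qed.

(* Write f = t^a p' / (t^b q') near 1 with p' and q' nonzero at 0; for fixed s,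
   f(s t) = f(s) f(t) is a polynomial identity in t, and t = 0 yields f(s). *)
Lemma Gm_character (f : Gms -> k) : {morph f : s t / (s * t)%g >-> s * t} ->
  f 1%g != 0 -> regular f (1%g : Gm) -> exists a b : nat,
    forall t : Gm, f t = val t ^+ a / val t ^+ b.
Proof.
move=> fM f1 /Gm_regular_poly[p [q [q1 fE]]].
have p1 : p.[1] != 0.
  by apply: contraNneq f1 => p1; rewrite fE // p1 mul0r.
have [p' [a [p0 pE]]] := poly_X_factor (poly_neq0 p1).
have [q' [b [q0 qE]]] := poly_X_factor (poly_neq0 q1).
exists a, b => s; have s0 : val s != 0 := valP s.
pose sX := lin_poly (val s) 0.
have sXE (r : {poly k}) x : (r \Po sX).[x] = r.[val s * x].
  by rewrite horner_comp_lin addr0.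
have P0 : (p' \Po sX) * q' * (val s ^+ a)%:P -
    (f s * val s ^+ b)%:P * p' * (q' \Po sX) = 0.
  apply: (@poly_eq0_off _ ('X * q * (q \Po sX))).
    by rewrite !mulf_neq0 ?polyX_eq0 ?comp_lin_neq0 ?(poly_neq0 q1).
  move=> x; rewrite !hornerM hornerX sXE !mulf_eq0 !negb_or => /andP[/andP[x0 qx] qsx].
  have [t tx] := gm_surj x0.
  have := fM s t; rewrite (fE t) ?tx // (fE (s * t)%g) ?Gm_valM ?tx //.
  move: qx qsx; rewrite pE qE !hornerM !hornerXn !mulf_eq0 !negb_or.
  move=> /andP[qx _] /andP[qsx _] e.
  rewrite hornerD hornerN !hornerM !hornerC !sXE; apply/eqP; rewrite subr_eq0.
  have sx0 : val s * x != 0 by rewrite mulf_neq0.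
  have := congr1 (fun z => z * (q'.[val s * x] * q'.[x] * (x ^+ b) * (val s) ^+ b / x ^+ a)) e.
  rewrite /= !exprMn => e'; apply/eqP.
  have xa : x ^+ a != 0 by rewrite expf_neq0.
  have xb : x ^+ b != 0 by rewrite expf_neq0.
  have sb : val s ^+ b != 0 by rewrite expf_neq0.
  transitivity (p'.[val s * x] * (val s ^+ a * x ^+ a) / (q'.[val s * x] * (val s ^+ b * x ^+ b)) *
    (q'.[val s * x] * q'.[x] * x ^+ b * val s ^+ b / x ^+ a)).
    by field; rewrite xa xb qsx sb.
  by rewrite e'; field; rewrite xa xb qx.
have := congr1 (fun r : {poly k} => r.[0]) P0.
rewrite hornerD hornerN !hornerM !hornerC !sXE mulr0 => /eqP.
rewrite subr_eq0 => /eqP e.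
have sb : val s ^+ b != 0 by rewrite expf_neq0.
apply: (mulIf sb); rewrite divfK //.
apply: (mulfI (mulf_neq0 p0 q0)); rewrite e; ring.
Qed.

End MultiplicativeGroup.

(** * Injective characters over an algebraically closed field *)

Section Closed.
Variable k : numClosedFieldType.
Local Notation Gm := (Gm k).
Local Notation Gms := (space_of Gm).

Lemma nontrivial_root_of_unity n : (1 < n)%N ->
  exists2 z : k, z ^+ n = 1 & z != 1.
Proof.
(* p = 1 + X + ... + X^(n-1) is the quotient of X^n - 1 by X - 1, and p(1) = n is nonzero in
   characteristic 0, so a root of p is the required z. *)
move=> n1; pose p : {poly k} := \poly_(i < n) 1.
have sp : size p = n by rewrite size_poly_eq ?oner_eq0.
have pE x : p.[x] = \sum_(i < n) x ^+ i.
  by rewrite horner_poly; apply: eq_bigr => i _; rewrite mul1r.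
have /closed_rootP[z /rootP pz] : size p != 1%N by rewrite sp gtn_eqF.
exists z; first by apply/eqP; rewrite -subr_eq0 subrX1 -pE pz mulr0.
apply: contra_eq_neq pz => ->; rewrite pE.
under eq_bigr do rewrite expr1n.
by rewrite sumr_const card_ord Num.Theory.pnatr_eq0 -lt0n ltnW.
Qed.

(** The element -1 excludes n = 0, and an n-th root of unity other than 1 excludes n >= 2. *)
Lemma injective_power (n : nat) :
  (forall s t : Gm, val s ^+ n = val t ^+ n -> s = t) -> n = 1%N.
Proof.
case: n => [|[//|n]] h.
  have n0 : (-1 : k) != 0 by rewrite oppr_eq0 oner_eq0.
  have /(congr1 val) /= /eqP := h (gm n0) 1%g (erefl 1).
  by rewrite -subr_eq0 -opprD oppr_eq0 -mulr2n Num.Theory.pnatr_eq0.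
have [z zn z1] := @nontrivial_root_of_unity n.+2 isT.
have z0 : z != 0.
  by apply: contra_eq_neq zn => ->; rewrite expr0n /= eq_sym oner_neq0.
have /(congr1 val) /= e : gm z0 = 1%g by apply: h; rewrite /= zn expr1n.
by rewrite e eqxx in z1.
Qed.

(** By [Gm_character] f is a power map of exponent a - b, possibly negative, and injectivity forces
    the exponent to be 1 or -1. *)
Lemma Gm_injective_character (f : Gms -> k) :
  {morph f : s t / (s * t)%g >-> s * t} -> f 1%g != 0 ->
  regular f (1%g : Gm) -> injective f ->
  (forall t : Gm, f t = val t) \/ (forall t : Gm, f t = (val t)^-1).
Proof.
move=> fM f1 rf fI; have [a [b fE]] := Gm_character fM f1 rf.
have v0 (t : Gm) n : val t ^+ n != 0 by rewrite expf_neq0 ?(valP t).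
have [ba|ab] := leqP b a.
  have fE' (t : Gm) : f t = val t ^+ (a - b).
    by rewrite fE expfB_cond ?(negbTE (valP t)).
  have n1 : (a - b = 1)%N.
    by apply: injective_power => s t e; apply: fI; rewrite !fE'.
  by left=> t; rewrite fE' n1 expr1.
have fE' (t : Gm) : f t = (val t ^+ (b - a))^-1.
  by rewrite fE -invf_div expfB_cond ?(negbTE (valP t)) // ltnW.
have n1 : (b - a = 1)%N.
  by apply: injective_power => s t e; apply: fI; rewrite !fE' e.
by right=> t; rewrite fE' n1 expr1.
Qed.

End Closed.

(** * The torus T_{0,1} as a one-parameter group *)

Section Tau.
Variable k : numFieldType.
Local Notation P2 := (proj k 2).
Local Notation Gm := (Gm k).
Local Notation pnt x y := (@ratio3 k x y 1).

Lemma affine_form_ext (f : bir P2) u u' : (forall x y, u x y = u' x y) ->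
  affine_form f u -> affine_form f u'.
Proof. by move=> e [W [oW dW h]]; exists W; split=> // x y /h; rewrite e. Qed.

Lemma tau_exists (s : Gm) :
  exists f : bir P2, affine_form f (fun x y => (x, val s * y)).
Proof.
have d0 : (1 * 1 - 0 * 0 : {poly k}) != 0 by rewrite mulr1 mul0r subr0 oner_neq0.
have [f ff] := jonq_exists 0 d0 (valP s); exists f.
apply: affine_form_ext ff => x y.
by rewrite !hornerC mul1r mul0r addr0 add0r divr1 addr0.
Qed.

(** The choice is immaterial: by [affine_form_inj] only one transformation has this affine form. *)
Definition tau (s : Gm) : bir P2 := sval (cid (tau_exists s)).

Lemma tau_form s : affine_form (tau s) (fun x y => (x, val s * y)).
Proof. exact: svalP (cid (tau_exists s)). Qed.

Lemma affine_form_inj (f f' : bir P2) u :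
  affine_form f u -> affine_form f' u -> f = f'.
Proof.
move=> h h'; apply: (affine_form_eq h h' (zopenT _)) => //; exact: zdenseT.
Qed.

Lemma tauM : {morph tau : s t / (s * t)%g}.
Proof.
move=> s t; apply: (affine_form_inj (tau_form (s * t)%g)).
apply: affine_form_ext (affine_form_comp (tau_form s) (tau_form t)) => x y.
by rewrite Gm_valM mulrA.
Qed.

Lemma tau_inj : injective tau.
Proof.
move=> s t e; have fs := tau_form s; have ft := tau_form t; rewrite e in fs.
have [] := @affine_form_snd_unique k _ _ _ (val s) 0 (val t) 0 fs ft.
- by move=> x y; rewrite addr0.
- by move=> x y; rewrite addr0.
- by move=> /val_inj.
Qed.

Lemma T01P (f : bir P2) : T01 f <-> exists s, f = tau s.
Proof.
split=> [[t t0 ft]|[s ->]].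
  by exists (gm t0); apply: (affine_form_inj ft); exact: (tau_form (gm t0)).
by exists (val s); [exact: (valP s)|exact: tau_form].
Qed.

End Tau.

(* Two homographies that agree at 0, 1 and infinity are equal: here
   [lam v2, mu v1], the homography with values v2, v1 and a multiple of v3 at
   infinity, 0 and 1, is composed with [a, b; c, d] and compared with the one
   attached to the images v1', v2', v3'. *)
Lemma homography_three_points (k : fieldType)
    (a b c d p1 q1 p2 q2 p3 q3 p1' q1' p2' q2' p3' q3' x : k) :
  let lam := p1 * q3 - q1 * p3 in let mu := p3 * q2 - q3 * p2 in
  let lam' := p1' * q3' - q1' * p3' in let mu' := p3' * q2' - q3' * p2' in
  let N := lam * p2 * x + mu * p1 in let D := lam * q2 * x + mu * q1 in
  let N' := lam' * p2' * x + mu' * p1' in let D' := lam' * q2' * x + mu' * q1' in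
  a * d - b * c != 0 ->
  p1' * (c * p1 + d * q1) = q1' * (a * p1 + b * q1) ->
  p2' * (c * p2 + d * q2) = q2' * (a * p2 + b * q2) ->
  p3' * (c * p3 + d * q3) = q3' * (a * p3 + b * q3) ->
  D != 0 -> D' != 0 ->
  (a * (N / D) + b) / (c * (N / D) + d) = N' / D'.
Proof.
move=> lam mu lam' mu' N D N' D' det h1 h2 h3 D0 D'0.
have E : (a * N + b * D) * D' = (c * N + d * D) * N'.
  apply/eqP; rewrite -subr_eq0; apply/eqP.
  (* The difference of the two sides of E is quadratic in x, hence determined by its values at 0 and
     1 and its leading coefficient. These are multiples of H at the first, third and second point;
     for instance N = p3 (p1 q2 - q1 p2) at x = 1. *)
  pose H p q p' q' := q' * (a * p + b * q) - p' * (c * p + d * q).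
  transitivity ((x ^+ 2 - x) * (lam * lam') * H p2 q2 p2' q2'
    + (1 - x) * (mu * mu') * H p1 q1 p1' q1'
    + x * ((p1 * q2 - q1 * p2) * (p1' * q2' - q1' * p2')) * H p3 q3 p3' q3').
    by rewrite /N /D /N' /D' /lam /mu /lam' /mu' /H; ring.
  by rewrite /H h1 h2 h3 !subrr !mulr0 !addr0.
have cd : c * N + d * D != 0.
  apply/eqP => z; have az : a * N + b * D = 0.
    by apply: (mulIf D'0); rewrite E z !mul0r.
  have : (a * d - b * c) * D = a * (c * N + d * D) - c * (a * N + b * D) by ring.
  by rewrite z az !mulr0 subr0 => /eqP; rewrite mulf_eq0 (negbTE det) (negbTE D0).
have -> : a * (N / D) + b = (a * N + b * D) / D by field.
have -> : c * (N / D) + d = (c * N + d * D) / D by field.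
rewrite invf_div mulrA divfK //.
by apply/eqP; rewrite eqr_div // E mulrC.
Qed.

(** * Invariant sections of a one-parameter family *)

Section Family.
Variable k : numFieldType.
Local Notation P2 := (proj k 2).
Local Notation Gm := (Gm k).
Local Notation Gms := (space_of Gm).
Local Notation pnt x y := (@ratio3 k x y 1).
Local Notation F := {fraction {poly k}}.

(** * Formulas for a single transformation, extended to the domain of a given representative *)

Section Transformation.
Variables (f : bir P2) (U : set P2) (Psi : P2 -> P2) (M : 'M[F]_2) (t : Aff1 k).
Hypothesis Psi_morphism : morphism_on U Psi.
Hypothesis Psi_f : exists W : set P2,
  [/\ zopen W, zdense W & forall w, W w -> sends f w (Psi w)].
Hypothesis f_form : jonquieres_form f M t.

Let good : set P2 := [set p | U p /\ chart (Psi p)].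

Let regular_cxPsi p : good p -> @regular k P2 (@cx k \o Psi) p.
Proof. by move=> [Up cp]; apply: (Psi_morphism Up).2; exact: regular_cx. Qed.

Let regular_cyPsi p : good p -> @regular k P2 (@cy k \o Psi) p.
Proof. by move=> [Up cp]; apply: (Psi_morphism Up).2; exact: regular_cy. Qed.

Let Psi_generic : exists W : set P2, [/\ zopen W, zdense W &
  forall w, chart w -> W w -> let x := cx w in let y := cy w in
    Psi w = pnt ((rat_eval (M 0 0) y * x + rat_eval (M 0 1) y) /
     (rat_eval (M 1 0) y * x + rat_eval (M 1 1) y)) ((val t).1 * y + (val t).2)].
Proof.
have [W1 [oW1 dW1 h1]] := Psi_f; have [W2 [oW2 dW2 h2]] := f_form.
exists (W1 `&` W2); split; [exact: zopenI|exact: zdenseI|].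
move=> w cw [/h1[_ <-] W2w]; move: W2w; rewrite {1}(chartP cw) => /h2[_].
by rewrite -(chartP cw).
Qed.

(** The form of f describes Psi only at generic points; [regular_eq_dense] carries the formula to
    every point of U sent into the chart, which is needed at the points of an orbit. *)
Lemma family_snd x y : U (pnt x y) -> chart (Psi (pnt x y)) ->
  cy (Psi (pnt x y)) = (val t).1 * y + (val t).2.
Proof.
move=> Up cp; have [W [oW dW h]] := Psi_generic.
have c0 := chart_ratio3 x y.
have := @regular_eq_dense k P2 W (@chart k) (@cy k \o Psi)
  (fun w => (val t).1 * cy w + (val t).2) (pnt x y).
rewrite /= cy_ratio3; apply=> //; first exact: local_units_P2.
- exact: zopen_chart.
- exact: regular_cyPsi.
- apply: regularD; last exact: regularC.
  by apply: regularM; [exact: regularC|exact: regular_cy].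
- by move=> w cw Ww; rewrite (h _ cw Ww) cy_ratio3.
Qed.

(** The homography is stated with its denominator cleared: both sides are then regular even where
    that denominator vanishes, and the identity extends from generic points. *)
Lemma family_fst x y :
  (forall i j, (den (M i j)).[y] != 0) ->
  rat_eval (M 0 0) y * rat_eval (M 1 1) y
      - rat_eval (M 0 1) y * rat_eval (M 1 0) y != 0 ->
  U (pnt x y) -> chart (Psi (pnt x y)) ->
  cx (Psi (pnt x y)) * (rat_eval (M 1 0) y * x + rat_eval (M 1 1) y) =
    rat_eval (M 0 0) y * x + rat_eval (M 0 1) y.
Proof.
move=> dM detM Up cp; have [W [oW dW h]] := Psi_generic.
have c0 := chart_ratio3 x y.
pose n i j : {poly k} := \n_(repr (M i j)).
(* a1 x + a0 is the denominator of the homography times the denominators of its two coefficients; it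
   is not identically zero because M is invertible at y. *)
pose a1 := n 1 0 * den (M 1 1); pose a0 := n 1 1 * den (M 1 0).
have dD : zdense (affine_locus a1 a0).
  apply: affine_locus_dense; rewrite -negb_and; apply: contra detM.
  move=> /andP[/eqP z1 /eqP z0].
  have n10 : (n 1 0).[y] = 0.
    by apply: (mulIf (dM 1 1)); rewrite -hornerM -/a1 z1 horner0 mul0r.
  have n11 : (n 1 1).[y] = 0.
    by apply: (mulIf (dM 1 0)); rewrite -hornerM -/a0 z0 horner0 mul0r.
  rewrite !rat_evalE -!/(n _ _) n10 n11.
  by rewrite !mul0r !mulr0 subrr.
pose O : set P2 := (@chart k `&` [set L | (den (M 1 0)).[cy L] != 0]) `&`
  [set L | (den (M 1 1)).[cy L] != 0].
have oO : zopen O.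
  apply: zopen_chart_regular => [|L [cL _]].
    apply: zopen_chart_regular => [|L cL]; first exact: zopen_chart.
    by apply: regular_horner; exact: regular_cy.
  by apply: regular_horner; exact: regular_cy.
have re i j : @regular k P2 (fun w => rat_eval (M i j) (cy w)) (pnt x y).
  apply: regular_rat_eval; [exact: local_units_P2|exact: regular_cy|].
  by rewrite cy_ratio3.
have := @regular_eq_dense k P2 (W `&` affine_locus a1 a0) O
  (fun w => (@cx k \o Psi) w *
     (rat_eval (M 1 0) (cy w) * cx w + rat_eval (M 1 1) (cy w)))
  (fun w => rat_eval (M 0 0) (cy w) * cx w + rat_eval (M 0 1) (cy w)) (pnt x y).
rewrite /= cy_ratio3 cx_ratio3; apply=> //; first exact: local_units_P2.
- exact: zdenseI.
- by split=> /=; [split=> //=|]; rewrite cy_ratio3.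
- apply: regularM; first exact: regular_cxPsi.
  apply: regularD; last exact: re.
  by apply: regularM; [exact: re|exact: regular_cx].
- apply: regularD; last exact: re.
  by apply: regularM; [exact: re|exact: regular_cx].
- move=> w [[cw /= d0] /= d1] [Ww [_ /= lw]].
  rewrite (h _ cw Ww) cx_ratio3 divfK //; apply: contra lw => /eqP e.
  rewrite /a1 /a0 !hornerM.
  have := congr1 (fun z => z * ((den (M 1 0)).[cy w] * (den (M 1 1)).[cy w])) e.
  rewrite mul0r !rat_evalE -!/(n _ _) => <-; apply/eqP; field.
  by rewrite d0 d1.
Qed.

End Transformation.

(** * A one-parameter group over the base action y |-> s y + c (1 - s) *)

Variables (f : Gm -> bir P2) (Us : Gm -> set P2) (Phi : Gm -> P2 -> P2) (c : k).
Hypothesis fM : {morph f : s t / (s * t)%g}.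
Hypothesis fJ : forall s, exists2 M, M \in unitmx &
  exists2 t : Aff1 k, val t = (val s, c * (1 - val s)) & jonquieres_form (f s) M t.
Hypothesis Us_open : forall s, zopen (Us s).
Hypothesis Phi_morphism : forall s, morphism_on (Us s) (Phi s).
Hypothesis orbit_open : forall p, @zopen k Gms [set s | Us s p].
Hypothesis orbit_morphism : forall p,
  @morphism_on k Gms P2 [set s | Us s p] (fun s => Phi s p).
Hypothesis Phi_f : forall s, exists W : set P2, [/\ zopen W, zdense W &
  forall w, W w -> Us s w /\ sends (f s) w (Phi s w)].

Let Phi_sends s : exists W : set P2, [/\ zopen W, zdense W &
  forall w, W w -> sends (f s) w (Phi s w)].
Proof. by have [W [oW dW h]] := Phi_f s; exists W; split=> // w /h[]. Qed.

Lemma family_one : exists W : set P2, [/\ zopen W, zdense W &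
  forall w, W w -> Us 1%g w /\ Phi 1%g w = w].
Proof.
have [W [oW dW h]] := Phi_f 1%g.
have f1 : f 1%g = 1%g by apply: (mulgI (f 1%g)); rewrite -fM !mulg1.
have [W' [oW' dW' h']] := repr_bireq (pid P2).
exists (W `&` W'); split; [exact: zopenI|exact: zdenseI|].
move=> w [/h[Uw [_ e]] /h'[_ _ e']]; split=> //.
by rewrite -e f1 [LHS]e'.
Qed.

(** The group law holds at generic points of the plane. Both sides are morphisms near p, and the
    chart conditions provide regular coordinates to which the identity principle applies. *)
Lemma family_mul s t p : Us s p -> Us t (Phi s p) -> chart (Phi t (Phi s p)) ->
  Us (t * s)%g p -> chart (Phi (t * s)%g p) -> Phi t (Phi s p) = Phi (t * s)%g p.
Proof.
move=> Up Up' cp Ups cps.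
have [W1 [oW1 dW1 h1]] := Phi_sends s; have [W2 [oW2 dW2 h2]] := Phi_sends t.
have [W3 [oW3 dW3 h3]] := Phi_sends (t * s)%g.
have [W [oW dW h]] := sends_mul (f t) (f s).
pose D := pdom (repr (f s)) `&` pfun (repr (f s)) @^-1` W2.
have oD : zopen D.
  by apply: preimage_open => //; [exact: pdom_open|exact: pfun_morphism].
have dD : zdense ((W `&` W1) `&` (W3 `&` D)).
  apply: zdenseI; [exact: zopenI|exact: zdenseI|].
  by apply: zdenseI => //; exact: pdom_comp_dense.
have agree w : ((W `&` W1) `&` (W3 `&` D)) w -> Phi t (Phi s w) = Phi (t * s)%g w.
  move=> [[Ww /h1 s1] [/h3[_ e3] [_ /= W2w]]].
  have [_ e1] := s1; rewrite e1 in W2w.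
  by have [_] := h _ _ _ Ww s1 (h2 _ W2w); rewrite -fM e3.
have m1 : @morphism_at k P2 P2 (Phi t \o Phi s) p.
  by apply: morphism_at_comp; exact: Phi_morphism.
have m2 := Phi_morphism Ups.
have ag (g : P2 -> k) : @regular k P2 g (Phi t (Phi s p)) ->
    @regular k P2 g (Phi (t * s)%g p) ->
    g (Phi t (Phi s p)) = g (Phi (t * s)%g p).
  move=> r1 r2.
  apply: (@regular_eq_dense k P2 _ setT (g \o (Phi t \o Phi s))
    (g \o Phi (t * s)%g) p (@local_units_P2 k) dD (zopenT _)) => //.
  - exact: m1.2.
  - exact: m2.2.
  - by move=> w _ Dw /=; rewrite agree.
rewrite (chartP cp) (chartP cps); congr ratio3; apply: ag;
  by [exact: regular_cx|exact: regular_cy].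
Qed.

(** The first coordinate of the orbit is a regular function of s near 1, hence a fraction P / Q; the
    second one is imposed by the action on the base. *)
Lemma orbit_param x y : Us 1%g (pnt x y) -> Phi 1%g (pnt x y) = pnt x y ->
  exists P Q : {poly k}, [/\ Q.[1] != 0, P.[1] = x * Q.[1] &
    forall s : Gm, Q.[val s] != 0 -> Us s (pnt x y) /\
      Phi s (pnt x y) = pnt (P.[val s] / Q.[val s]) (val s * y + c * (1 - val s))].
Proof.
move=> U1 Phi1; set p := pnt x y in U1 Phi1 *.
pose O : set Gms := [set s | Us s p /\ chart (Phi s p)].
have oO : @zopen k Gms O.
  apply: (@zopen_preimage k Gms P2 [set s | Us s p] (fun s => Phi s p));
    [exact: orbit_open|exact: orbit_morphism|exact: zopen_chart].
have [|q [q1 qO]] := @Gm_open_poly k O 1%g oO.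
  by split=> //; rewrite Phi1; exact: chart_ratio3.
have r1 : @regular k Gms (@cx k \o (fun s => Phi s p)) (1%g : Gm).
  apply: (@orbit_morphism p (1%g : Gm) U1).2 => /=.
  by rewrite Phi1; apply: regular_cx; exact: chart_ratio3.
have [P [Q [Q1 PQ]]] := Gm_regular_poly r1.
have qQ1 : (Q * q).[1] != 0 by rewrite hornerM mulf_neq0.
have E (s : Gm) : (Q * q).[val s] != 0 -> Us s p /\
    Phi s p = pnt ((P * q).[val s] / (Q * q).[val s]) (val s * y + c * (1 - val s)).
  rewrite hornerM mulf_eq0 negb_or => /andP[Qs qs].
  have [Usp cs] := qO _ qs; split=> //.
  rewrite (chartP cs); congr ratio3.
    by have /= -> := PQ _ Qs; rewrite !hornerM -mulf_div divff // mulr1.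
  have [M uM [t tE ft]] := fJ s.
  rewrite (family_snd (@Phi_morphism s) (Phi_sends s) ft Usp cs).
  by rewrite tE.
(* The factor q, nonzero only where the orbit is defined and in the chart, is absorbed in the
   denominator. *)
exists (P * q), (Q * q); split=> //.
have [_] := E 1%g qQ1; rewrite Phi1 => /ratio3_inj[e _].
by rewrite e divfK.
Qed.

(* The orbit curve s |-> (P s / Q s, c + d s) of a point of the line
   y = c + d is invariant. *)
Lemma orbit_invariant x d P Q (t : Gm) M (u : Aff1 k) : d != 0 ->
  Us 1%g (pnt x (c + d)) -> Phi 1%g (pnt x (c + d)) = pnt x (c + d) ->
  Q.[1] != 0 -> (forall s : Gm, Q.[val s] != 0 -> Us s (pnt x (c + d)) /\
      Phi s (pnt x (c + d)) = pnt (P.[val s] / Q.[val s])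
        (val s * (c + d) + c * (1 - val s))) ->
  Q.[val t] != 0 ->
  M \in unitmx -> val u = (val t, c * (1 - val t)) -> jonquieres_form (f t) M u ->
  exists H : {poly k}, H != 0 /\ forall s, H.[s] != 0 ->
    P.[val t * s] * (rat_eval (M 1 0) (d * s + c) * P.[s]
      + rat_eval (M 1 1) (d * s + c) * Q.[s]) =
    Q.[val t * s] * (rat_eval (M 0 0) (d * s + c) * P.[s]
      + rat_eval (M 0 1) (d * s + c) * Q.[s]).
Proof.
move=> d0 U1 Phi1 Q1 E Qt uM uE ft; set p := pnt x (c + d) in U1 Phi1 E *.
have [Ut Phit] := E _ Qt.
pose O : set Gms := [set s | (Us s p /\ Us t (Phi s p)) /\ chart (Phi t (Phi s p))].
have oO : @zopen k Gms O.
  apply: (@zopen_preimage k Gms P2 [set s | Us s p /\ Us t (Phi s p)]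
    (fun s => Phi t (Phi s p))).
  - apply: (@zopen_preimage k Gms P2 [set s | Us s p] (fun s => Phi s p));
      [exact: orbit_open|exact: orbit_morphism|exact: Us_open].
  - move=> s [Us1 Us2].
    apply: (@morphism_at_comp k Gms P2 P2 (Phi t) (fun s => Phi s p)).
      exact: orbit_morphism.
    exact: Phi_morphism.
  - exact: zopen_chart.
(* The parameter s = 1 belongs to O: the orbit passes through p there, and f_t is defined at p with
   image in the chart because Q(t) != 0. *)
have [|q [q1 qO]] := @Gm_open_poly k O 1%g oO.
  by split; [split=> //|]; rewrite Phi1 // Phit; exact: chart_ratio3.
have [qM [qM0 hM]] := rat_mx_generic uM.
pose tX := lin_poly (val t) 0; pose dX := lin_poly d c.
have tXE (r : {poly k}) z : (r \Po tX).[z] = r.[val t * z].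
  by rewrite horner_comp_lin addr0.
have dXE (r : {poly k}) z : (r \Po dX).[z] = r.[d * z + c].
  exact: horner_comp_lin.
(* The factors ensure in turn that s is in G_m, that f_t is defined at the orbit point with image in
   the chart, that the orbit formula holds at s and at t s, and that M can be evaluated at the base
   point d s + c. *)
exists ('X * q * Q * (Q \Po tX) * (qM \Po dX)); split.
  have t0 : val t != 0 := valP t.
  by rewrite !mulf_neq0 ?polyX_eq0 ?comp_lin_neq0 ?(poly_neq0 q1) ?(poly_neq0 Q1).
move=> z; rewrite !hornerM hornerX tXE dXE !mulf_eq0 !negb_or.
move=> /andP[/andP[/andP[/andP[z0 qz] Qz] Qtz] qMz].
have [dens dets] := hM _ qMz.
have [s sz] := gm_surj z0; rewrite -sz in qz Qz Qtz dens dets *.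
have [[Us1 Us2] cs] := qO _ qz; have [_ Phis] := E _ Qz.
have [Uts Phits] := E (t * s)%g Qtz.
have yE : val s * (c + d) + c * (1 - val s) = d * val s + c by ring.
rewrite yE in Phis.
(* The image of the orbit point under f_t is computed twice: by the group law it is the orbit point
   of parameter t s, and by [family_fst] it is given by M. *)
have := family_mul Us1 Us2 cs Uts.
rewrite Phits => /(_ (chart_ratio3 _ _)); rewrite Phis => e.
rewrite Phis in Us2 cs.
have := family_fst (@Phi_morphism t) (Phi_sends t) ft dens dets Us2 cs.
rewrite e cx_ratio3 Gm_valM => e1.
have := congr1 (fun w => w * (Q.[val t * val s] * Q.[val s])) e1.
move=> /= e2.
transitivity (P.[val t * val s] / Q.[val t * val s] *
  (rat_eval (M 1 0) (d * val s + c) * (P.[val s] / Q.[val s])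
   + rat_eval (M 1 1) (d * val s + c)) * (Q.[val t * val s] * Q.[val s])).
  by field; rewrite Qz Qtz.
by rewrite e2; field.
Qed.


(** In the fibre of parameter s, g sends 0, infinity and 1 to the points p1/q1, p2/q2 and p3/q3 over
    d s + c, and h moves each of these to its value at t s. Hence h g and g (x, t y) agree at three
    points of a generic fibre. *)
Lemma sections_conjugate (t : Gm) (h g : bir P2) (M : 'M[F]_2) (u : Aff1 k) d
    (p1 q1 p2 q2 p3 q3 : {poly k}) :
  let lam := p1 * q3 - q1 * p3 in let mu := p3 * q2 - q3 * p2 in
  let inv p q H := forall s, H.[s] != 0 ->
    p.[val t * s] * (rat_eval (M 1 0) (d * s + c) * p.[s]
      + rat_eval (M 1 1) (d * s + c) * q.[s]) =
    q.[val t * s] * (rat_eval (M 0 0) (d * s + c) * p.[s]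
      + rat_eval (M 0 1) (d * s + c) * q.[s]) in
  d != 0 -> M \in unitmx -> val u = (val t, c * (1 - val t)) ->
  jonquieres_form h M u ->
  lam * q2 != 0 ->
  affine_form g (fun x y => (((lam * p2).[y] * x + (mu * p1).[y]) /
    ((lam * q2).[y] * x + (mu * q1).[y]), d * y + c)) ->
  (exists H : {poly k}, H != 0 /\ inv p1 q1 H) ->
  (exists H : {poly k}, H != 0 /\ inv p2 q2 H) ->
  (exists H : {poly k}, H != 0 /\ inv p3 q3 H) ->
  (h * g = g * tau t)%g.
Proof.
move=> lam mu inv d0 uM uE hM lq gform [H1 [H10 h1]] [H2 [H20 h2]] [H3 [H30 h3]].
have [qM [qM0 hqM]] := rat_mx_generic uM.
pose tX := lin_poly (val t) 0; pose dX := lin_poly d c.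
have tXE (r : {poly k}) z : (r \Po tX).[z] = r.[val t * z].
  by rewrite horner_comp_lin addr0.
have dXE (r : {poly k}) z : (r \Po dX).[z] = r.[d * z + c].
  exact: horner_comp_lin.
have qMd : qM \Po dX != 0 by exact: comp_lin_neq0.
have lqt : (lam * q2) \Po tX != 0 := comp_lin_neq0 0 (valP t) lq.
pose H := H1 * H2 * H3 * (qM \Po dX).
have H0 : H != 0 by rewrite !mulf_neq0.
pose W1 := affine_locus 0 H; pose W2 := affine_locus (lam * q2) (mu * q1).
pose W3 := affine_locus ((lam * q2) \Po tX) ((mu * q1) \Po tX).
have dW1 : zdense W1 by apply: affine_locus_dense; rewrite H0 orbT.
have dW2 : zdense W2 by apply: affine_locus_dense; rewrite lq.
have dW3 : zdense W3 by apply: affine_locus_dense; rewrite lqt.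
have oW1 : zopen W1 := affine_locus_open _ _.
have oW2 : zopen W2 := affine_locus_open _ _.
have oW3 : zopen W3 := affine_locus_open _ _.
apply: (@affine_form_eq k _ _ _ _ (W1 `&` (W2 `&` W3))
  (affine_form_comp hM gform) (affine_form_comp gform (tau_form t))).
- by apply: zopenI => //; exact: zopenI.
- by apply: zdenseI => //; exact: zdenseI.
move=> x s [/affine_locusP Hs [/affine_locusP D0 /affine_locusP D0']].
rewrite horner0 mul0r add0r /H !hornerM dXE !mulf_eq0 !negb_or in Hs.
move: Hs => /andP[/andP[/andP[/h1 e1 /h2 e2] /h3 e3] /hqM[_ detM]].
rewrite !tXE in D0'; rewrite /= uE /=; congr (_, _); last by ring.
move: D0 D0'; rewrite /lam /mu !(hornerM, hornerD, hornerN) => D0 D0'.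
exact: (homography_three_points detM e1 e2 e3 D0 D0').
Qed.

Lemma family_three_points : exists d x1 x2 x3, [/\ d != 0, x1 != x2, x1 != x3,
  x2 != x3 & forall x, x \in [:: x1; x2; x3] ->
    Us 1%g (pnt x (c + d)) /\ Phi 1%g (pnt x (c + d)) = pnt x (c + d)].
Proof.
have [W [oW dW h]] := family_one.
(* The fibre y = c is avoided: the base action fixes c, so an orbit there stays in the fibre and is
   not a section. *)
have dl : zdense (@affine_locus k 0 ('X - c%:P)).
  by apply: affine_locus_dense; rewrite polyXsubC_eq0 orbT.
have [|x [y [Wxy /affine_locusP]]] :=
    plane_open_point (zopenI oW (affine_locus_open 0 ('X - c%:P))).
  have [|L [_ WlL]] := zdenseI oW dW dl (zopenT _); first by exists (pnt 0 0).
  by exists L.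
rewrite horner0 mul0r add0r hornerXsubC => yc.
have [q [qx qW]] := plane_open_hline oW Wxy.
have q0 := poly_neq0 qx.
have XsubC_neq0 (a : k) : 'X - a%:P != 0 by rewrite polyXsubC_eq0.
have [x1 qx1] := poly_nonroot q0.
have [x2] := poly_nonroot (mulf_neq0 q0 (XsubC_neq0 x1)).
rewrite hornerM hornerXsubC mulf_eq0 negb_or subr_eq0 => /andP[qx2 x21].
have [x3] := poly_nonroot (mulf_neq0 (mulf_neq0 q0 (XsubC_neq0 x1)) (XsubC_neq0 x2)).
rewrite !hornerM !hornerXsubC !mulf_eq0 !negb_or !subr_eq0.
move=> /andP[/andP[qx3 x31] x32].
exists (y - c), x1, x2, x3.
have -> : c + (y - c) = y by rewrite addrC subrK.
split=> //.
- by rewrite eq_sym.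
- by rewrite eq_sym.
- by rewrite eq_sym.
by move=> z; rewrite !inE => /or3P[] /eqP ->; apply: h; exact: qW.
Qed.

Lemma family_conjugate : exists2 g, @PGL2_Aff1 k g &
  forall s, f s = (g * tau s * g^-1)%g.
Proof.
have [d [x1 [x2 [x3 [d0 x12 x13 x23 hx]]]]] := family_three_points.
have [|U1 Phi1] := hx x1; first by rewrite !inE eqxx.
have [|U2 Phi2] := hx x2; first by rewrite !inE eqxx orbT.
have [|U3 Phi3] := hx x3; first by rewrite !inE eqxx !orbT.
have [p1 [q1 [q11 p11 E1]]] := orbit_param U1 Phi1.
have [p2 [q2 [q21 p21 E2]]] := orbit_param U2 Phi2.
have [p3 [q3 [q31 p31 E3]]] := orbit_param U3 Phi3.
(* The sections pass through distinct points at s = 1, so their cross determinants are nonzero; up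
   to sign, the determinant of g is the product of the three. *)
have cross p q p' q' x x' : x != x' -> q.[1] != 0 -> q'.[1] != 0 ->
    p.[1] = x * q.[1] -> p'.[1] = x' * q'.[1] -> p * q' - q * p' != 0 :> {poly k}.
  move=> xx q0 q0' e e'; apply: (@poly_neq0 k _ 1).
  rewrite hornerD hornerN !hornerM e e'.
  have -> : x * q.[1] * q'.[1] - q.[1] * (x' * q'.[1]) = (x - x') * (q.[1] * q'.[1]).
    by ring.
  by rewrite !mulf_neq0 // subr_eq0.
pose lam := p1 * q3 - q1 * p3; pose mu := p3 * q2 - q3 * p2.
have lam0 : lam != 0 by apply: cross x13 _ _ p11 p31.
have mu0 : mu != 0 by apply: (cross _ _ _ _ x3 x2) => //; rewrite eq_sym.
have det0 : lam * p2 * (mu * q1) - mu * p1 * (lam * q2) != 0.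
  have -> : lam * p2 * (mu * q1) - mu * p1 * (lam * q2) =
    - (lam * mu * (p1 * q2 - q1 * p2)) by ring.
  by rewrite oppr_eq0 !mulf_neq0 //; apply: cross x12 _ _ p11 p21.
have [g gform] := jonq_exists c det0 d0.
have gconj (t : Gm) : (q1 * q2 * q3).[val t] != 0 -> (f t * g = g * tau t)%g.
  rewrite !hornerM !mulf_eq0 !negb_or => /andP[/andP[q1t q2t] q3t].
  have [M uM [u uE ft]] := fJ t.
  apply: (sections_conjugate d0 uM uE ft _ gform).
  - by rewrite mulf_neq0 // (poly_neq0 q21).
  - exact: orbit_invariant d0 U1 Phi1 q11 E1 q1t uM uE ft.
  - exact: orbit_invariant d0 U2 Phi2 q21 E2 q2t uM uE ft.
  - exact: orbit_invariant d0 U3 Phi3 q31 E3 q3t uM uE ft.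
exists g.
  pose m : 'M[F]_2 := \matrix_(i < 2, j < 2) tofrac
    (if i == 0 then (if j == 0 then lam * p2 else mu * p1)
     else (if j == 0 then lam * q2 else mu * q1)).
  exists m.
    by rewrite unitmxE unitfE det_mx2 !mxE /= -!tofracM -tofracB tofrac_eq0.
  have uP : ((d, c) : k * k).1 != 0 by [].
  exists (exist (fun p : k * k => p.1 != 0) (d, c) uP).
  have [W [oW dW h]] := gform.
  (* Even for a polynomial, [rat_eval] uses the chosen fraction, whose denominator may have zeros; D
     removes the fibres over them. *)
  pose D := den (m 0 0) * den (m 0 1) * (den (m 1 0) * den (m 1 1)).
  have D0 : D != 0 by rewrite !mulf_neq0 // den_neq0.
  exists (W `&` affine_locus 0 D); split.
  - by apply: zopenI => //; exact: affine_locus_open.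
  - by apply: zdenseI => //; apply: affine_locus_dense; rewrite D0 orbT.
  move=> x y [/h s /affine_locusP].
  rewrite horner0 mul0r add0r /D !hornerM !mulf_eq0 !negb_or.
  move=> /andP[/andP[d00 d01] /andP[d10 d11]].
  move: d00 d01 d10 d11; rewrite !mxE /= => d00 d01 d10 d11.
  by rewrite !rat_eval_tofrac.
move=> s; pose q := q1 * q2 * q3; pose sX := lin_poly (val s) 0.
have sXE (r : {poly k}) z : (r \Po sX).[z] = r.[val s * z].
  by rewrite horner_comp_lin addr0.
have q0 : q != 0 by rewrite !mulf_neq0 // ?(poly_neq0 q11) ?(poly_neq0 q21) ?(poly_neq0 q31).
have qs0 : q \Po sX != 0 := comp_lin_neq0 0 (valP s) q0.
(* An arbitrary s is reached from generic parameters: r is chosen so that the conjugation is known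
   for both r and s r, and f_s = f_(s r) f_r^-1. *)
have [r] := Gm_nonroot (mulf_neq0 q0 qs0).
rewrite hornerM sXE mulf_eq0 negb_or => /andP[/gconj er /(gconj (s * r)%g) esr].
apply: (mulIg (f r)); rewrite -fM.
have -> : f r = (g * tau r * g^-1)%g by rewrite -er mulgK.
by rewrite -[LHS](mulgK g) esr tauM !mulgA mulgKV.
Qed.

End Family.

(** * The projection pr_2 as a homomorphism *)

Section Pr2.
Variable k : numFieldType.
Local Notation P2 := (proj k 2).

Lemma pr2_form (f : bir P2) : PGL2_Aff1 f ->
  exists2 M, M \in unitmx & jonquieres_form f M (pr2 f).
Proof.
move=> [M uM [t ft]]; rewrite /pr2; case: xgetP => [t' _ //|].
by move=> /(_ t) []; exists M.
Qed.

Lemma pr2E (f : bir P2) u a b : PGL2_Aff1 f -> affine_form f u ->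
  (forall x y, (u x y).2 = a * y + b) -> val (pr2 f) = (a, b).
Proof.
move=> /pr2_form[M uM ff] fu ue.
have [e1 e2] := affine_form_snd_unique ff fu (fun _ _ => erefl) ue.
by rewrite -e1 -e2; case: (val (pr2 f)).
Qed.

Lemma pr2M (f g : bir P2) : PGL2_Aff1 f -> PGL2_Aff1 g -> PGL2_Aff1 (f * g)%g ->
  pr2 (f * g)%g = (pr2 f * pr2 g)%g.
Proof.
move=> hf hg hfg; apply: val_inj.
have [M _ ff] := pr2_form hf; have [N _ fg] := pr2_form hg.
apply: (pr2E hfg (affine_form_comp ff fg)) => x y /=.
by rewrite mulrDr mulrA addrA.
Qed.

End Pr2.

(** * Algebraic families of birational transformations *)

Section Families.
Variable k : numFieldType.
Local Notation P2 := (proj k 2).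
Local Notation Gm := (Gm k).
Local Notation Gms := (space_of Gm).
Local Notation pnt x y := (@ratio3 k x y 1).

Lemma morphism_GmV : @Defs.morphism k Gms Gms (fun s : Gm => s^-1)%g.
Proof.
move=> s _; apply: morphism_at_Gm; first exact: local_units_Gm.
have [_] := local_units_Gm (fun s : Gm => val s); apply.
  exact: regular_Gm_val.
exact: (valP s).
Qed.

(** * Conjugates of the torus as algebraic families *)

Section Conjugates.
Variables (A : kspace k) (g : bir P2).
Implicit Types e : A -> k.
Let G := repr g.

Definition scale (c : k) (L : P2) : P2 := pnt (cx L) (c * cy L).

Lemma scaleK c L : c != 0 -> chart L -> scale c^-1 (scale c L) = L.
Proof.
move=> c0 cL; rewrite /scale cx_ratio3 cy_ratio3 mulKf //.
by rewrite -chartP.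
Qed.

(** The family over A pulls a point back by g, scales y by e(a), and pushes the result forward by g.
    The function e is a parameter because the inverse family is the same construction for 1 / e. *)
Let U e : set (sprod A P2) := [set z |
  (pcod G z.2 /\ chart (pinv G z.2)) /\ pdom G (scale (e z.1) (pinv G z.2))].
Let Phi e (z : sprod A P2) : sprod A P2 :=
  (z.1, pfun G (scale (e z.1) (pinv G z.2))).

Let D : set (sprod A P2) := [set z | pcod G z.2 /\ chart (pinv G z.2)].

Let D_open : zopen D.
Proof.
have oD : zopen (pcod G `&` pinv G @^-1` @chart k).
  apply: preimage_open; [exact: pcod_open|exact: pinv_morphism|exact: zopen_chart].
have -> : D = [set z | setT z /\ (pcod G `&` pinv G @^-1` @chart k) z.2].
  by apply/seteqP; split=> z => [|[]].
apply: zopen_preimage oD; first exact: zopenT.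
by move=> z _; exact: morphism_at_snd.
Qed.

Let scale_morphism e : (forall a, regular e a) -> forall z, D z ->
  @morphism_at k (sprod A P2) P2 (fun z => scale (e z.1) (pinv G z.2)) z.
Proof.
move=> re z [Gz cz].
have m : @morphism_at k (sprod A P2) P2 (fun z => pinv G z.2) z.
  apply: (@morphism_at_comp k (sprod A P2) P2 P2 (pinv G) snd).
    exact: morphism_at_snd.
  exact: pinv_morphism.
apply: morphism_at_ratio3; first exact: local_units_sprod.
  by apply: (m.2 (@cx k)); exact: regular_cx.
apply: regularM; first exact: ((morphism_at_fst z).2 e (re z.1)).
by apply: (m.2 (@cy k)); exact: regular_cy.
Qed.

Let U_open e : (forall a, regular e a) -> zopen (U e).
Proof.
move=> re; apply: zopen_preimage; [exact: D_open|exact: scale_morphism|].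
exact: pdom_open.
Qed.

Let Phi_morphism e : (forall a, regular e a) -> morphism_on (U e) (Phi e).
Proof.
move=> re z [Dz Uz]; apply: morphism_at_pair; first exact: local_units_sprod.
  exact: morphism_at_fst.
apply: (@morphism_at_comp k (sprod A P2) P2 P2 (pfun G)
  (fun z => scale (e z.1) (pinv G z.2))); first exact: scale_morphism.
exact: pfun_morphism.
Qed.

Let scale_dom c : c != 0 -> zopen [set L | chart L /\ pdom G (scale c L)] /\
  zdense [set L | chart L /\ pdom G (scale c L)].
Proof.
move=> c0; have o : zopen [set L | chart L /\ pdom G (scale c L)].
  apply: zopen_preimage; [exact: zopen_chart| |exact: pdom_open].
  move=> L cL; apply: morphism_at_ratio3; first exact: local_units_P2.
    exact: regular_cx.
  by apply: regularM; [exact: regularC|exact: regular_cy].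
split=> //; apply: proj_open_dense => //.
have [|x [y Gxy]] := plane_open_point (pdom_open G).
  have [|L [_ GL]] := pdom_dense G (zopenT _); last by exists L.
  by exists (pnt 0 0).
exists (pnt x (y / c)); split; first exact: chart_ratio3.
by rewrite /= /scale cx_ratio3 cy_ratio3 mulrC divfK.
Qed.

Let U_slice e a : e a != 0 -> exists w, U e (a, w).
Proof.
move=> e0; have [o d] := scale_dom e0.
have [|L [GL [cL sL]]] := d _ (pdom_open G).
  have [|L [_ GL]] := pdom_dense G (zopenT _); last by exists L.
  by exists (pnt 0 0).
have [cG eG] := pfunP GL.
by exists (pfun G L); rewrite /U /= eG.
Qed.

Let PhiK e e' z : (forall a, e a != 0) -> (forall a, e' a = (e a)^-1) -> U e z ->
  [/\ U e' (Phi e z), Phi e' (Phi e z) = z & (Phi e z).1 = z.1].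
Proof.
move=> e0 ee [[Gz cz] Uz]; have [cG eG] := pfunP Uz.
have [dG eG'] := pinvP Gz.
split=> //; rewrite /U /Phi /= ?eG ee scaleK //.
  by split=> //; split=> //; exact: chart_ratio3.
by rewrite eG'; case: (z).
Qed.

Lemma bir_morphism_conj (u : A -> Gms) : Defs.morphism u ->
  bir_morphism (fun a => g * tau (u a) * g^-1)%g.
Proof.
move=> mu; pose e a := val (u a); pose e' a := (val (u a))^-1.
have re a : regular e a.
  by apply: ((mu a I).2 (fun s : Gm => val s)); exact: regular_Gm_val.
have re' a : regular e' a.
  apply: ((mu a I).2 (fun s : Gm => (val s)^-1)).
  have [_] := local_units_Gm (fun s : Gm => val s); apply.
    exact: regular_Gm_val.
  exact: (valP (u a)).
have e0 a : e a != 0 := valP (u a).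
have e0' a : e' a != 0 := Gm_inv_subproof (u a).
have ee' a : e a = (e' a)^-1 by rewrite invrK.
exists (U e), (U e'), (Phi e), (Phi e'); split.
- by split; [exact: (U_open re)|exact: (U_open re')].
- by split=> a; [exact: (U_slice (e0 a))|exact: (U_slice (e0' a))].
- by split; [exact: (Phi_morphism re)|exact: (Phi_morphism re')].
- by split=> z Uz; [exact: PhiK|have [] := PhiK e0' ee' Uz].
move=> a; have [oS dS] := scale_dom (e0 a).
have [W1 [oW1 dW1 h1]] := sends_mul (g * tau (u a))%g g^-1%g.
have [W2 [oW2 dW2 h2]] := sends_mul g (tau (u a)).
have [W3 [oW3 dW3 h3]] := tau_form (u a).
(* The representative chosen for g^-1 agrees only generically with the inverse of the one chosen for
   g, which defines the family. *)
have [W4 [oW4 dW4 h4]] := repr_bireq (pinverse G).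
pose S := [set L | chart L /\ pdom G (scale (e a) L)] `&` (W2 `&` W3).
have oS' : zopen S by apply: zopenI => //; exact: zopenI.
have dS' : zdense S by apply: zdenseI => //; exact: zdenseI.
exists ((W1 `&` W4) `&` (pcod G `&` pinv G @^-1` S)); split.
- apply: zopenI; first exact: zopenI.
  by apply: preimage_open => //; [exact: pcod_open|exact: pinv_morphism].
- apply: zdenseI; [exact: zopenI|exact: zdenseI|].
  exact: (@pdom_comp_dense k P2 (pinverse G) S oS' dS').
move=> w [[W1w /h4[d4 _ e4]] [Gw [[cw sw] [W2w W3w]]]]; split.
  by split.
apply: (h1 _ (pinv G w)) => //.
apply: (h2 _ (scale (e a) (pinv G w))) => //.
by move: W3w; rewrite /= {1}(chartP cw) => /h3; rewrite -(chartP cw).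
Qed.

End Conjugates.

(** Pulling the isomorphism over A back along w |-> (v s, w) gives the transformation of parameter
    s, and along s |-> (v s, p) the orbit map of p. *)
Lemma bir_morphism_slices (A : kspace k) (mu : A -> bir P2) (v : Gms -> A) :
  bir_morphism mu -> Defs.morphism v ->
  exists (Us : Gm -> set P2) (Phi : Gm -> P2 -> P2),
  [/\ forall s, zopen (Us s), forall s, morphism_on (Us s) (Phi s),
    forall p, @zopen k Gms [set s | Us s p],
    forall p, @morphism_on k Gms P2 [set s | Us s p] (fun s => Phi s p) &
    forall s, exists W : set P2, [/\ zopen W, zdense W &
      forall w, W w -> Us s w /\ sends (mu (v s)) w (Phi s w)]].
Proof.
move=> [U [V [F [F' [[oU _] _ [mF _] _ h]]]]] mv.
have m1 s w : @morphism_at k P2 (sprod A P2) (fun w => (v s, w)) w.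
  apply: morphism_at_pair; first exact: local_units_P2.
    exact: morphism_at_cst.
  exact: morphism_at_id.
have m2 s w : @morphism_at k Gms (sprod A P2) (fun s => (v s, w)) s.
  apply: morphism_at_pair; [exact: local_units_Gm|exact: mv|].
  exact: morphism_at_cst.
have mF2 z : U z -> @morphism_at k (sprod A P2) P2 (fun z => (F z).2) z.
  move=> Uz; apply: (@morphism_at_comp k (sprod A P2) (sprod A P2) P2 snd F);
    first exact: mF.
  exact: morphism_at_snd.
exists (fun s => [set w | U (v s, w)]), (fun s w => (F (v s, w)).2); split.
- move=> s; apply: (@zopen_nbhs k P2) => w Uw.
  have [O [oO Ow OU]] := (m1 s w).1 _ oU Uw.
  by exists O.
- move=> s w Uw; apply: (@morphism_at_comp k P2 (sprod A P2) P2 (fun z => (F z).2)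
    (fun w => (v s, w))) => //; exact: mF2.
- move=> p; apply: (@zopen_nbhs k Gms) => s Us.
  have [O [oO Ow OU]] := (m2 s p).1 _ oU Us.
  by exists O.
- move=> p s Us; apply: (@morphism_at_comp k Gms (sprod A P2) P2 (fun z => (F z).2)
    (fun s => (v s, p))) => //; exact: mF2.
- by move=> s; exact: h.
Qed.

Lemma irreducible_image (X Y : kspace k) (v : X -> Y) (u : Y -> X) :
  Defs.morphism v -> cancel u v -> irreducible X -> irreducible Y.
Proof.
move=> mv uv [[x _] h]; split=> [|F1 F2 c1 c2 F12]; first by exists (v x).
have cl F : zclosed F -> zclosed (v @^-1` F).
  move=> cF; have -> : v @^-1` F = ~` [set x | setT x /\ (~` F) (v x)].
    apply/seteqP; split=> y /=; first by move=> Fy [].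
    by move=> nF; apply: contrapT => nFy; apply: nF.
  rewrite /zclosed setCK; apply: zopen_preimage; [exact: zopenT|exact: mv|exact: cF].
have [|e|e] := h _ _ (cl _ c1) (cl _ c2).
- by apply/seteqP; split=> // z _; have : (F1 `|` F2) (v z) by rewrite F12.
- left; apply/seteqP; split=> // y _; rewrite -(uv y).
  by have : (v @^-1` F1) (u y) by rewrite e.
- right; apply/seteqP; split=> // y _; rewrite -(uv y).
  by have : (v @^-1` F2) (u y) by rewrite e.
Qed.

End Families.

(** * Tori of PGL_2(C(y)) x| Aff_1 *)

Section Equivalence.
Variable k : numClosedFieldType.
Local Notation P2 := (proj k 2).
Local Notation Gm := (Gm k).
Local Notation Gms := (space_of Gm).
Local Notation Aff1 := (Aff1 k).
Variables (G : set (bir P2)) (K : group_space k) (phi : K -> bir P2).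
Hypothesis G_PGL2 : G `<=` @PGL2_Aff1 k.
Hypothesis G_natural : natural_structure G phi.

(** The inverse v is kept along with u because s |-> phi (v s) is the one-parameter group under
    study; the pair is replaced by its composite with inversion when the character found on the base
    is t^-1. *)
Definition Gm_chart (u : space_of K -> Gms) (v : Gms -> space_of K) :=
  [/\ Defs.morphism u, Defs.morphism v, cancel u v, cancel v u &
      forall s t : Gm, v (s * t)%g = ((v s : K) * v t)%g].

Lemma Gm_chart_exists : group_isomorphic K Gm -> exists u v, Gm_chart u v.
Proof.
move=> [u [uM [mu [v [mv uv vu]]]]]; exists u, v; split=> // s t.
by apply: (can_inj uv); rewrite uM !vu.
Qed.

Lemma Gm_chart_inv u v : Gm_chart u v ->
  Gm_chart (fun x => (u x)^-1)%g (fun s => v (s : Gm)^-1%g).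
Proof.
move=> [mu mv uv vu vM]; split.
- move=> x _; apply: (@morphism_at_comp k (space_of K) Gms Gms (fun s : Gm => s^-1)%g u).
    exact: mu.
  exact: morphism_GmV.
- move=> s _; apply: (@morphism_at_comp k Gms Gms (space_of K) v (fun s : Gm => s^-1)%g).
    exact: morphism_GmV.
  exact: mv.
- by move=> x; rewrite invgK uv.
- by move=> s; rewrite vu invgK.
- move=> s t; rewrite -vM; congr v; apply: val_inj.
  by rewrite Gm_valM !Gm_valV Gm_valM invfM.
Qed.

Lemma phi_PGL2 x : PGL2_Aff1 (phi x).
Proof. by apply: G_PGL2; have [_ _ _ <- _] := G_natural; exists x. Qed.

Lemma phiM : {morph phi : x y / (x * y)%g}.
Proof. by have [] := G_natural. Qed.

Lemma pr2_phiM : {morph (fun x => pr2 (phi x)) : x y / (x * y)%g}.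
Proof.
move=> x y /=; rewrite phiM pr2M //; try exact: phi_PGL2.
by rewrite -phiM; exact: phi_PGL2.
Qed.

Lemma local_units_Aff1 : local_units (space_of Aff1).
Proof. exact/local_units_induced/local_units_affine. Qed.

Lemma regular_Aff1_fst (t : Aff1) :
  @regular k (space_of Aff1) (fun t : Aff1 => (val t).1) t.
Proof.
have := (@morphism_at_val k Aff1 (affine k 2)
  (fun t => \row_(i < 2) [:: (val t).1; (val t).2]`_i) t).2
  (fun v => v ord0 0) (regular_coord 0 _).
by apply: (@regular_local k (space_of Aff1) setT) => // [|s _ /=];
  [exact: zopenT|rewrite mxE].
Qed.

Lemma normal_form_conj u v c : Gm_chart u v ->
  (forall s : Gm, val (pr2 (phi (v s))) = (val s, c * (1 - val s))) ->
  exists2 g, @PGL2_Aff1 k g & forall s : Gm, phi (v s) = (g * tau s * g^-1)%g.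
Proof.
move=> [mu mv uv vu vM] nf; have [algK _ _ _ nat] := G_natural.
have iK : irreducible (space_of K) by exact: irreducible_image mv uv (@irreducible_Gm k).
(* The tautological family: the natural structure is applied to the identity morphism of K. *)
have bphi : bir_morphism (phi : space_of K -> bir P2).
  have [vK _ _] := algK; apply/(nat _ vK iK id) => x _; exact: morphism_at_id.
have [Us [Phi [h1 h2 h3 h4 h5]]] := bir_morphism_slices bphi mv.
have fM : {morph (fun s : Gm => phi (v s)) : s t / (s * t)%g}.
  by move=> s t; rewrite vM phiM.
have fJ s : exists2 M, M \in unitmx & exists2 t : Aff1,
    val t = (val s, c * (1 - val s)) & jonquieres_form (phi (v s)) M t.
  by have [M uM fM'] := pr2_form (phi_PGL2 (v s)); exists M => //; exists (pr2 (phi (v s))).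
exact: family_conjugate fM fJ h1 h2 h3 h4 h5.
Qed.

Lemma normal_form_induces u v c : Gm_chart u v ->
  (forall s : Gm, val (pr2 (phi (v s))) = (val s, c * (1 - val s))) ->
  induces_group_isomorphism (fun x : K => pr2 (phi x)) (@pr2 k @` G).
Proof.
move=> [mu mv uv vu vM] nf; split; first exact: pr2_phiM.
have [_ _ _ ran _] := G_natural.
have inH x : pr2 (phi x) \in @pr2 k @` G.
  by rewrite inE; exists (phi x) => //; rewrite -ran; exists x.
pose w x : @sub k (space_of Aff1) (@pr2 k @` G) := exist _ (pr2 (phi x)) (inH x).
exists w; split=> //.
have HP (z : @sub k (space_of Aff1) (@pr2 k @` G)) :
    exists s : Gm, val z = pr2 (phi (v s)).
  have := valP z; rewrite inE => -[f Gf <-]; move: Gf; rewrite -ran => -[x _ <-].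
  by exists (u x); rewrite uv.
have lS : local_units (@sub k (space_of Aff1) (@pr2 k @` G)).
  by apply: local_units_sub; exact: local_units_Aff1.
have mw : @Defs.morphism k Gms (@sub k (space_of Aff1) (@pr2 k @` G))
    (fun s => w (v s)).
  move=> s _; do 2 apply: morphism_at_induced.
  apply: morphism_at_affine => [|i]; first exact: local_units_Gm.
  case: (ord2P i) => ->.
    apply: (regular_local (zopenT _) _ _ (regular_Gm_val s)) => // t _ /=.
    by rewrite mxE /= nf.
  have r : @regular k Gms (fun t => c * (1 - val t)) s.
    apply: regularM; first exact: regularC.
    by apply: regularB; [exact: regularC|exact: regular_Gm_val].
  apply: (regular_local (zopenT _) _ _ r) => // t _ /=.
  by rewrite mxE /= nf.
(* In normal form the linear part of the affine map is s itself, so reading it off is an algebraic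
   inverse. *)
pose r (z : @sub k (space_of Aff1) (@pr2 k @` G)) : Gm :=
  gm (valP (val z : Aff1)).
have rw s : r (w (v s)) = s by apply: val_inj; rewrite /= nf.
split.
  move=> x _; have e : w = (fun s => w (v s)) \o u.
    by apply: funext => y /=; rewrite uv.
  rewrite e; apply: (@morphism_at_comp k _ _ _ (fun s => w (v s)) u).
    exact: mu.
  exact: mw.
exists (fun z => v (r z)); split.
- move=> z _; apply: (@morphism_at_comp k _ _ _ v r); last exact: mv.
  apply: morphism_at_Gm; first exact: lS.
  have r1 := (@morphism_at_val k _ (space_of Aff1) _ z).2 _ (regular_Aff1_fst _).
  exact: r1.
- by move=> x; rewrite -{1}(uv x) rw uv.
- move=> z; have [s zs] := HP z.
  have -> : z = w (v s) by exact: val_inj.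
  by rewrite rw.
Qed.

(* An injective algebraic representation of Gm by affine maps fixes a point:
   all its elements commute with one that has a linear part other than 1, and
   -1 would be sent to a translation of order 2 if there were none. *)
Lemma induces_normal_form u v : Gm_chart u v ->
  induces_group_isomorphism (fun x : K => pr2 (phi x)) (@pr2 k @` G) ->
  exists u' v' c, Gm_chart u' v' /\
    forall s : Gm, val (pr2 (phi (v' s))) = (val s, c * (1 - val s)).
Proof.
move=> ch [prM [w [wE [mw [w' [_ ww' _]]]]]].
have [mu mv uv vu vM] := ch.
pose rho (s : Gm) := pr2 (phi (v s)).
have rhoM : {morph rho : s t / (s * t)%g} by move=> s t; rewrite /rho vM prM.
have rhoI : injective rho.
  move=> s t e; apply: (can_inj vu); apply: (can_inj ww').
  by apply: val_inj; rewrite !wE.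
pose f (s : Gms) : k := (val (rho s)).1; pose b (s : Gm) : k := (val (rho s)).2.
have fM : {morph f : s t / (s * t)%g >-> s * t}.
  by move=> s t; rewrite /f rhoM.
have bM s t : b (s * t)%g = f s * b t + b s by rewrite /b rhoM.
have f0 s : f s != 0 := valP (rho s).
have rf : @regular k Gms f (1%g : Gm).
  have r1 : @regular k (space_of K) (fun x => (val (val (w x) : Aff1)).1) (v 1%g).
    apply: ((mw (v 1%g) I).2 (fun z => (val (val z : Aff1)).1)).
    have r2 := (@morphism_at_val k _ (space_of Aff1) _ (w (v 1%g))).2 _
      (regular_Aff1_fst _).
    exact: r2.
  apply: (@regular_local k Gms setT _ _ _ (zopenT _) _ _ ((mv 1%g I).2 _ r1)) => //.
  by move=> s _ /=; rewrite wE.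
have rho_inj s t : f s = f t -> b s = b t -> s = t.
  move=> fst bst; apply: rhoI; apply: val_inj; move: fst bst; rewrite /f /b.
  by case: (val (rho s)) (val (rho t)) => [? ?] [? ?] /= -> ->.
have f1 : f 1%g = 1.
  by apply: (mulfI (f0 1%g)); rewrite -fM mulg1 mulr1.
have b1 : b 1%g = 0.
  have := bM 1%g 1%g; rewrite mulg1 f1 mul1r => /eqP.
  by rewrite -subr_eq0 opprD addNKr oppr_eq0 => /eqP.
have [s0 s0P] : exists s0, f s0 != 1.
  apply: contrapT => /forallNP h.
  have fs s : f s = 1 by apply/eqP; apply: contrapT => /negP; exact: h.
  have n0 : (-1 : k) != 0 by rewrite oppr_eq0 oner_eq0.
  have e : (gm n0 * gm n0)%g = 1%g by apply: val_inj; rewrite /= mulrNN mulr1.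
  have bn : b (gm n0) = 0.
    have := bM (gm n0) (gm n0); rewrite e b1 fs mul1r => /esym/eqP.
    by rewrite -mulr2n -mulr_natl mulf_eq0 Num.Theory.pnatr_eq0 => /eqP.
  have /(congr1 val) /= /eqP : gm n0 = 1%g by apply: rho_inj; rewrite ?fs // bn b1.
  by rewrite -subr_eq0 -opprD oppr_eq0 -mulr2n Num.Theory.pnatr_eq0.
have s00 : 1 - f s0 != 0 by rewrite subr_eq0 eq_sym.
pose c := b s0 / (1 - f s0).
have bE s : b s = c * (1 - f s).
  apply: (mulIf s00); rewrite /c.
  have -> : b s0 / (1 - f s0) * (1 - f s) * (1 - f s0) = b s0 * (1 - f s) by field.
  have := bM s s0; have -> : (s * s0 = s0 * s)%g by apply: val_inj; rewrite /= mulrC.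
  rewrite bM => e.
  have -> : b s * (1 - f s0) = b s - (f s0 * b s + b s0) + b s0 by ring.
  by rewrite e; ring.
have fI : injective f by move=> s t e; apply: rho_inj => //; rewrite !bE e.
have nf s : val (rho s) = (f s, c * (1 - f s)).
  by rewrite -bE /f /b; case: (val (rho s)).
have f10 : f 1%g != 0 by rewrite f1 oner_neq0.
have [fE|fE] := Gm_injective_character fM f10 rf fI.
  by exists u, v, c; split=> // s; rewrite [LHS]nf fE.
exists (fun x => (u x)^-1)%g, (fun s => v (s : Gm)^-1%g), c.
split; first exact: Gm_chart_inv.
by move=> s; rewrite [LHS]nf fE invrK.
Qed.

Lemma conj_normal_form u v g : Gm_chart u v -> @PGL2_Aff1 k g ->
  G = [set (g * t * g^-1)%g | t in @T01 k] ->
  exists u' v' c, Gm_chart u' v' /\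
    forall s : Gm, val (pr2 (phi (v' s))) = (val s, c * (1 - val s)).
Proof.
move=> ch gP GE; have [mu mv uv vu vM] := ch.
have [[vK _ _] phM phI ran nat] := G_natural.
pose psi (x : K) := (g * tau (u x) * g^-1)%g.
have inG (s : Gm) : exists x, phi x = (g * tau s * g^-1)%g.
  have : G (g * tau s * g^-1)%g by rewrite GE; exists (tau s) => //; apply/T01P; exists s.
  by rewrite -ran => -[x _ <-]; exists x.
(* h is the endomorphism of K that compares the given parametrisation of G with the conjugated
   torus. It is chosen pointwise, and it is a morphism because phi \o h is an algebraic family. *)
have [h hE] := choice (fun x : K => inG (u x)).
have iK : irreducible (space_of K) by exact: irreducible_image mv uv (@irreducible_Gm k).
have mh : @Defs.morphism k (space_of K) (space_of K) h.
  apply/(nat _ vK iK); have -> : phi \o h = psi by apply: funext => x /=; rewrite hE.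
  exact: bir_morphism_conj.
have [M uM [[[a b] /= a0] gform]] := gP.
(* The base part y |-> a y + b of g sends the fixed point 0 of y |-> s y to b, so the conjugate is
   the dilation of ratio s centred at b. *)
have pr2h (s : Gm) x : phi x = (g * tau s * g^-1)%g ->
    val (pr2 (phi x)) = (val s, b * (1 - val s)).
  move=> e; have [N uN fN] := pr2_form (phi_PGL2 x).
  have e' : (phi x * g = g * tau s)%g by rewrite e mulgKV.
  have := affine_form_comp fN gform; rewrite e' => F1.
  have F2 := affine_form_comp gform (tau_form s).
  set t := pr2 (phi x) in F1 fN *.
  have [||e1 e2] := @affine_form_snd_unique k _ _ _ ((val t).1 * a)
    ((val t).1 * b + (val t).2) (a * val s) b F1 F2.
  - by move=> x' y' /=; ring.
  - by move=> x' y' /=; ring.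
  have ts : (val t).1 = val s by apply: (mulIf a0); rewrite e1 mulrC.
  rewrite [LHS]surjective_pairing ts; congr (_, _).
  by apply: (addrI (val s * b)); rewrite -{1}ts e2; ring.
pose f (s : Gms) : k := val (u (h (v s))).
have hM s t : h (v (s * t)%g) = (h (v s) * h (v t))%g.
  apply: phI; rewrite phM !hE !vu tauM.
  by rewrite !mulgA mulgKV.
have umul (x y : K) : u (x * y)%g = (u x * u y)%g.
  by rewrite -{1}(uv x) -{1}(uv y) -vM vu.
have fM : {morph f : s t / (s * t)%g >-> s * t}.
  by move=> s t; rewrite /f hM umul.
have f0 s : f s != 0 := valP (u (h (v s))).
have rf : @regular k Gms f (1%g : Gm).
  apply: ((mv 1%g I).2 (fun x => val (u (h x)))).
  apply: ((mh (v 1%g) I).2 (fun x => val (u x))).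
  apply: ((mu _ I).2 (fun s : Gm => val s)); exact: regular_Gm_val.
have fI : injective f.
  move=> s t /val_inj /(can_inj uv) e; apply: (@tau_inj k).
  have := hE (v t); rewrite -e hE !vu => /mulIg/mulgI //.
have [fE|fE] := Gm_injective_character fM (f0 1%g) rf fI.
  exists u, v, b; split=> // s; apply: pr2h.
  have -> : v s = h (v s) by apply: (can_inj uv); rewrite vu; apply: val_inj; rewrite -fE.
  by rewrite hE vu.
exists (fun x => (u x)^-1)%g, (fun s => v (s : Gm)^-1%g), b.
split; first exact: Gm_chart_inv.
move=> s; apply: pr2h.
have -> : v s^-1%g = h (v s).
  by apply: (can_inj uv); rewrite vu; apply: val_inj; rewrite Gm_valV -fE.
by rewrite hE vu.
Qed.

Lemma induces_iff_conjugate : group_isomorphic K Gm ->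
  induces_group_isomorphism (fun x : K => pr2 (phi x)) (@pr2 k @` G) <->
  exists2 g, @PGL2_Aff1 k g & G = [set (g * t * g^-1)%g | t in @T01 k].
Proof.
move=> /Gm_chart_exists[u [v ch]]; split; last first.
  move=> [g gP GE]; have [u' [v' [c [ch' nf]]]] := conj_normal_form ch gP GE.
  exact: normal_form_induces ch' nf.
move=> /(induces_normal_form ch)[u' [v' [c [ch' nf]]]].
have [g gP gE] := normal_form_conj ch' nf; exists g => //.
have [_ _ uv _ _] := ch'; have [_ _ _ <- _] := G_natural.
apply/seteqP; split=> f.
  move=> [x _ <-]; exists (tau (u' x)); first by apply/T01P; exists (u' x).
  by rewrite -gE uv.
by move=> [t /T01P[s ->] <-]; exists (v' s).
Qed.

End Equivalence.

Local Open Scope complex_scope.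

Theorem lemma8p2 (R : realType) (G : set (bir (P2 R[i])))
    (K : group_space R[i]) (phi : K -> bir (P2 R[i])) :
  algebraic_subgroup G ->
  G `<=` @PGL2_Aff1 R[i] ->
  natural_structure G phi ->
  group_isomorphic K (Gm R[i]) ->
  (induces_group_isomorphism (fun x : K => pr2 (phi x)) (@pr2 R[i] @` G)
   <->
   exists2 g, @PGL2_Aff1 R[i] g & G = [set (g * t * g^-1)%g | t in @T01 R[i]]).
Proof. by move=> _; exact: induces_iff_conjugate. Qed.
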